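(* Let $M$ and $N$ be smooth manifolds. Then the $D$-topology on $C^\infty(M,N)$ is contained in the strong topology.
   Context: All smooth manifolds are Hausdorff, finite-dimensional, second countable and without boundary. $C^\infty(M,N)$ is the set of smooth maps from $M$ to $N$. It is equipped with the functional diffeology, whose plots are the maps $p:U\to C^\infty(M,N)$ ($U$ open in some $\mathbb{R}^n$, $n\in\mathbb{N}$) such that the map $U\times M\to N$, $(u,x)\mapsto p(u)(x)$, is smooth. The $D$-topology on $C^\infty(M,N)$ is the topology in which a set $A$ is open if and only if $p^{-1}(A)$ is open in $U$ for every plot $p:U\to C^\infty(M,N)$. For $r\in\mathbb{N}$, a chart $(U,\phi)$ of $M$, a chart $(V,\psi)$ of $N$, a compact $K\subseteq U$, $f\in C^\infty(M,N)$ with $f(K)\subseteq V$, and $\epsilon>0$, let $N^r(f,(U,\phi),(V,\psi),K,\epsilon)$ be the set of all $g\in C^\infty(M,N)$ such that $g(K)\subseteq V$ and $\|D^i(\psi\circ f\circ\phi^{-1})(x)-D^i(\psi\circ g\circ\phi^{-1})(x)\|<\epsilon$ for each $x\in\phi(K)$ and each multi-index $i\in\mathbb{N}^m$ ($m=\dim M$) with $|i|\le r$, where $|i|=i_1+\cdots+i_m$ and $D^i=\frac{\partial^{|i|}}{\partial x_1^{i_1}\cdots\partial x_m^{i_m}}$. The strong topology on $C^\infty(M,N)$ has as subbasis the intersections $\bigcap_i N^r(f,(U_i,\phi_i),(V_i,\psi_i),K_i,\epsilon_i)$ of families of such sets (with common $r$ and $f$) for which the collection $\{U_i\}$ is locally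 finite. One topology is contained in another if every open set of the former is open in the latter. *)

(* Defs.v *)
From HB Require Import structures.
From mathcomp Require Import all_boot all_order all_algebra.
From mathcomp Require Import all_classical all_reals all_analysis.
Set Implicit Arguments.
Unset Strict Implicit.
Unset Printing Implicit Defensive.
Import Order.TTheory GRing.Theory Num.Theory.
Import numFieldNormedType.Exports.
Local Open Scope classical_set_scope.
Local Open Scope ring_scope.

Section Calculus.
Variables (R : realType) (m n : nat).
Implicit Types (g : 'rV[R]_m -> 'rV[R]_n) (W : set 'rV[R]_m).

Definition partial (j : 'I_m) g : 'rV[R]_m -> 'rV[R]_n :=
  'D_(delta_mx 0 j) g.

Definition partials (s : seq 'I_m) g := foldr partial g s.

(* The index sequence lists 0 (i 0) times, then 1 (i 1) times, and so on. *)
Definition multi_partial (i : 'I_m -> nat) g :=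
  partials (flatten [seq nseq (i j) j | j <- enum 'I_m]) g.

(* C^oo on W, for W open; the values of g outside W are irrelevant. *)
Definition smooth_on W g := forall (s : seq 'I_m) (x : 'rV[R]_m), W x ->
  {for x, continuous (partials s g)} /\
  forall j : 'I_m, derivable (partials s g) x (delta_mx 0 j).

Definition eucl_norm (v : 'rV[R]_n) : R := Num.sqrt (\sum_(j < n) v 0 j ^+ 2).

End Calculus.

(* The pair (U, phi) is encoded by total functions: cfun is phi on cdom and
   cinv is phi^-1 on phi(U); elsewhere their values are never used.          *)
Record chart (R : realType) (m : nat) (T : Type) := Chart {
  cdom : set T;
  cfun : T -> 'rV[R]_m;
  cinv : 'rV[R]_m -> T }.

Definition crange (R : realType) m (T : Type) (c : chart R m T) :=
  cfun c @` cdom c.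

(* phi is a homeomorphism from the open set U onto the open set phi(U). *)
Definition is_chart (R : realType) m (T : topologicalType) (c : chart R m T) :=
  [/\ open (cdom c), open (crange c),
      forall x, cdom c x -> cinv c (cfun c x) = x,
      forall x, cdom c x -> {for x, continuous (cfun c)} &
      forall y, crange c y -> {for y, continuous (cinv c)}].

Definition transition_smooth (R : realType) m (T : Type) (c d : chart R m T) :=
  smooth_on (cfun c @` (cdom c `&` cdom d)) (cfun d \o cinv c).

Record manifold (R : realType) (m : nat) := Manifold {
  msort :> topologicalType;
  atlas : set (chart R m msort);
  manifold_hausdorff : hausdorff_space msort;
  manifold_second_countable : @second_countable msort;
  atlas_chart : forall c, atlas c -> is_chart c;
  atlas_cover : forall x : msort, exists2 c, atlas c & cdom c x;
  atlas_smooth : forall c d, atlas c -> atlas d -> transition_smooth c d }.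
Arguments atlas {R m} _.

(* Membership in the maximal atlas. *)
Definition manifold_chart (R : realType) m (M : manifold R m)
    (c : chart R m M) :=
  is_chart c /\
  forall d, atlas M d -> transition_smooth c d /\ transition_smooth d c.

(* Smoothness of f on the union of the chart domains of an atlas A. *)
Definition smooth_wrt (R : realType) m n (T S : topologicalType)
    (A : set (chart R m T)) (B : set (chart R n S)) (f : T -> S) :=
  (forall c x, A c -> cdom c x -> {for x, continuous f}) /\
  (forall c d, A c -> B d ->
    smooth_on (cfun c @` (cdom c `&` f @^-1` cdom d))
              (cfun d \o f \o cinv c)).

(* The chart id_U x phi, with values in R^k x R^m = R^(k + m). *)
Definition prod_chart (R : realType) k m (T : Type) (U : set 'rV[R]_k)
    (c : chart R m T) : chart R (k + m) ('rV[R]_k * T)%type :=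
  {| cdom := U `*` cdom c;
     cfun := fun z => row_mx z.1 (cfun c z.2);
     cinv := fun y => (lsubmx y, cinv c (rsubmx y)) |}.

Definition prod_atlas (R : realType) k m (U : set 'rV[R]_k)
    (M : manifold R m) : set (chart R (k + m) ('rV[R]_k * M)%type) :=
  [set prod_chart U c | c in atlas M].
Arguments prod_atlas {R k m} U M.

Record Cinf (R : realType) m n (M : manifold R m) (N : manifold R n) :=
  MkCinf {
    cinf_fun :> M -> N;
    cinf_smooth : smooth_wrt (atlas M) (atlas N) cinf_fun }.

HB.instance Definition _ (R : realType) m n (M : manifold R m)
  (N : manifold R n) := gen_eqMixin (Cinf M N).
HB.instance Definition _ (R : realType) m n (M : manifold R m)
  (N : manifold R n) := gen_choiceMixin (Cinf M N).

Section DTopology.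
Variables (R : realType) (m n : nat) (M : manifold R m) (N : manifold R n).

(* The values of p outside U are irrelevant. *)
Definition plot k (U : set 'rV[R]_k) (p : 'rV[R]_k -> Cinf M N) :=
  open U /\
  smooth_wrt (prod_atlas U M) (atlas N)
             (fun z : ('rV[R]_k * M)%type => p z.1 z.2).

(* As U is open, a subset of U is open in U iff it is open in R^k. *)
Definition D_open (A : set (Cinf M N)) :=
  forall k (U : set 'rV[R]_k) (p : 'rV[R]_k -> Cinf M N),
    plot U p -> open (U `&` p @^-1` A).

Lemma D_openT : D_open setT.
Proof. by move=> k U p [oU _]; rewrite preimage_setT setIT. Qed.

Lemma D_openI : setI_closed D_open.
Proof.
move=> A B oA oB k U p pp; rewrite preimage_setI setIIr.
by apply: openI; [exact: oA|exact: oB].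
Qed.

Lemma D_open_bigU (I : Type) (F : I -> set (Cinf M N)) :
  (forall i, D_open (F i)) -> D_open (\bigcup_i F i).
Proof.
move=> oF k U p pp; rewrite preimage_bigcup setI_bigcupr.
by apply: bigcup_open => i _; exact: oF.
Qed.

Definition Cinf_D := Cinf M N.

HB.instance Definition _ := Choice.on Cinf_D.
HB.instance Definition _ :=
  isOpenTopological.Build Cinf_D D_openT D_openI D_open_bigU.

Definition D_topology : set (set (Cinf M N)) := @open Cinf_D.

End DTopology.
Arguments D_topology {R m n} M N.

Section StrongTopology.
Variables (R : realType) (m n : nat) (M : manifold R m) (N : manifold R n).

(* Indices are counted with multiplicity: each point has a neighbourhood
   meeting U i for only finitely many indices i.                           *)
Definition locally_finite (I : Type) (T : topologicalType) (U : I -> set T) :=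
  forall x : T, exists2 W, nbhs x W & finite_set [set i | W `&` U i !=set0].

Definition Nr_data (f : Cinf M N) (c : chart R m M) (d : chart R n N)
    (K : set M) (e : R) :=
  [/\ manifold_chart c, manifold_chart d, compact K /\ K `<=` cdom c,
      f @` K `<=` cdom d & 0 < e].

Definition Nr (r : nat) (f : Cinf M N) (c : chart R m M) (d : chart R n N)
    (K : set M) (e : R) : set (Cinf M N) :=
  [set g : Cinf M N | g @` K `<=` cdom d /\
    forall (x : 'rV[R]_m) (i : 'I_m -> nat), (cfun c @` K) x ->
      (\sum_(j < m) i j <= r)%N ->
      eucl_norm (multi_partial i (cfun d \o f \o cinv c) x -
                 multi_partial i (cfun d \o g \o cinv c) x) < e].

Definition strong_subbasis : set (set (Cinf M N)) :=
  [set S | exists (r : nat) (f : Cinf M N) (I : Type) (c : I -> chart R m M)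
      (d : I -> chart R n N) (K : I -> set M) (e : I -> R),
    [/\ forall i, Nr_data f (c i) (d i) (K i) (e i),
        locally_finite (fun i => cdom (c i)) &
        S = \bigcap_i Nr r f (c i) (d i) (K i) (e i)]].

Definition Cinf_strong := Cinf M N.

HB.instance Definition _ := Choice.on Cinf_strong.
HB.instance Definition _ :=
  @isSubBaseTopological.Build Cinf_strong (set (Cinf M N)) strong_subbasis id.

Definition strong_topology : set (set (Cinf M N)) := @open Cinf_strong.

End StrongTopology.
Arguments strong_topology {R m n} M N.

(* Main.v *)
(** Let A be D-open and contain f. If no strong neighbourhood of f lies in A,
    pick for each k a map g_k outside A which, on a fixed locally finite family
    of compact sets K_i covering M, is C^k-close to f up to a tolerance tending
    to 0 fast with k. A single smooth curve p of maps with p(0) = f and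
    p(t_k) = g_k for some t_k -> 0 then contradicts the openness of the preimage
    of A under p. The values of p in disjoint time slots around the t_k are
    obtained by moving f to g_k chart after chart: stage i replaces the current
    value z, over K_i and in a chart of N, by the convex combination
    (1 - b_i) z + b_i (f + mu_k(t) (g_k - f)), where b_i is a cutoff function
    on M and mu_k a bump with mu_k(t_k) = 1. C^0-closeness in the strong sense
    keeps all these combinations inside the charts, and the fast C^k-closeness
    makes t |-> f + mu_k(t) (g_k - f) smooth at t = 0. *)

(* The obstacle is that N has no linear structure: f and g_k can be joined only inside charts of N,
   so the path is a composite of moves, finitely many near each point. Every move must start and end
   in the chart that it uses. How close g_k must be to f for this depends on the chart index i
   alone, and compactness turns it into a radius del_i that does not depend on k. The other
   tolerance, eps_k, depends on k alone: it is fixed after the bump mu_k and makes its derivatives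
   of order at most k, times eps_k, smaller than the square of the left end of the k-th slot. The
   k-th neighbourhood uses min(del_i, eps_k) on the i-th compact set. A strong neighbourhood bounds
   derivatives up to one finite order only. This suffices because a derivative of given order of the
   curve, at time 0, sees only the slots beyond any given index, hence those where k exceeds that
   order. So a sequence of neighbourhoods is enough, although they need not form a base at f. *)
Require Import Defs.
From mathcomp Require Import all_boot all_order all_algebra.
From mathcomp Require Import all_classical all_reals all_analysis.
From mathcomp Require Import ring lra.
Set Implicit Arguments.
Unset Strict Implicit.
Unset Printing Implicit Defensive.
Import Order.TTheory GRing.Theory Num.Theory.
Import numFieldNormedType.Exports.
Local Open Scope classical_set_scope.
Local Open Scope ring_scope.

(** * Functions of class C^r along a family of directions *)

Section DirectionalSmoothness.
Variables (R : realType) (V : normedModType R) (I : Type) (e : I -> V).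
Implicit Types (g h : V -> R) (W : set V).

(** Values are real so that products make sense; vector-valued maps are treated entry by entry. The
    directions are a parameter because the same calculus serves R^m, the time line with its single
    direction, and R^(1 + m). *)
Fixpoint ckon (r : nat) W g : Prop :=
  (forall x, W x -> {for x, continuous g}) /\
  (if r is r'.+1 then
    forall j, (forall x, W x -> derivable g x (e j)) /\ ckon r' W ('D_(e j) g)
  else True).

Definition smooth W g := forall r, ckon r W g.

Lemma ckon_continuous r W g x : ckon r W g -> W x -> {for x, continuous g}.
Proof. by case: r => [|r] [+ _]; exact. Qed.

Lemma ckonS r W g : ckon r.+1 W g -> ckon r W g.
Proof.
elim: r g => [|r IH] g; first by case.
move=> [cg dg]; split=> // j; have [dgj dg'] := dg j.
by split=> //; exact: IH.
Qed.

Lemma ckonW r W W' g : W' `<=` W -> ckon r W g -> ckon r W' g.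
Proof.
move=> sW; elim: r g => [|r IH] g [cg dg]; split=> //.
- by move=> x /sW; exact: cg.
- by move=> x /sW; exact: cg.
- move=> j; have [dgj dg'] := dg j; split; last exact: IH.
  by move=> x /sW; exact: dgj.
Qed.

Lemma eq_ckon r W g h : open W -> (forall x, W x -> g x = h x) ->
  ckon r W g -> ckon r W h.
Proof.
move=> oW; elim: r g h => [|r IH] g h gh [cg dg].
  split=> // x Wx; have nW : nbhs x W by exact: open_nbhs_nbhs.
  rewrite /prop_for /continuous_at -gh//; apply: cvg_trans (cg x Wx).
  by apply: near_eq_cvg; near=> y; rewrite gh//; near: y.
have nW x : W x -> \near x, g x = h x.
  by move=> Wx; near=> y; apply: gh; near: y; exact: open_nbhs_nbhs.
split=> [x Wx|j].
  rewrite /prop_for /continuous_at -gh//; apply: cvg_trans (cg x Wx).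
  by apply: near_eq_cvg; exact: nW.
have [dgj dg'] := dg j; split.
  by move=> x Wx; exact: (near_eq_derivable (nW x Wx) (dgj x Wx)).
apply: IH dg' => x Wx; apply: near_eq_derive; exact: nW.
Unshelve. all: by end_near. Qed.

(** [ckon] is a condition at each point separately, with derivatives taken in the ambient space, so
    it passes from pieces to their union. *)
Lemma ckon_local r W g :
  (forall x, W x -> exists2 W', W' x & ckon r W' g) -> ckon r W g.
Proof.
elim: r g => [|r IH] g H.
  by split=> // x /H[W' W'x [cg _]]; exact: cg.
split=> [x /H[W' W'x [cg _]]|j]; first exact: cg.
split=> [x /H[W' W'x [_ /(_ j)[dg _]]]|]; first exact: dg.
by apply: IH => x /H[W' W'x [_ /(_ j)[_ dg]]]; exists W'.
Qed.

Lemma ckon_cst r W (a : R) : ckon r W (cst a).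
Proof.
elim: r a => [|r IH] a; (split; first by move=> x _; exact: cst_continuous) => //.
move=> j; split; first by move=> x _; exact: derivable_cst.
suff -> : 'D_(e j) (cst a : V -> R) = cst 0 by [].
by apply/funext => x; rewrite derive_cst.
Qed.

Lemma ckonD r W g h : open W -> ckon r W g -> ckon r W h ->
  ckon r W (fun x => g x + h x).
Proof.
move=> oW; elim: r g h => [|r IH] g h [cg dg] [ch dh];
  (split; first by move=> x Wx; apply: continuousD; [exact: cg|exact: ch]) => //.
move=> j; have [dgj dg'] := dg j; have [dhj dh'] := dh j; split.
  by move=> x Wx; apply: derivableD; [exact: dgj|exact: dhj].
apply: eq_ckon oW _ (IH _ _ dg' dh') => x Wx.
by rewrite (deriveD (dgj x Wx) (dhj x Wx)).
Qed.

Lemma ckonM r W g h : open W -> ckon r W g -> ckon r W h ->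
  ckon r W (fun x => g x * h x).
Proof.
move=> oW; elim: r g h => [|r IH] g h /[dup] Cg [cg dg] /[dup] Ch [ch dh];
  (split; first by move=> x Wx; apply: continuousM; [exact: cg|exact: ch]) => //.
move=> j; have [dgj dg'] := dg j; have [dhj dh'] := dh j; split.
  by move=> x Wx; apply: derivableM; [exact: dgj|exact: dhj].
have := ckonD oW (IH _ _ (ckonS Cg) dh') (IH _ _ (ckonS Ch) dg').
apply: eq_ckon oW _ => x Wx.
by rewrite (deriveM (dgj x Wx) (dhj x Wx)).
Qed.

Lemma ckonN r W g : open W -> ckon r W g -> ckon r W (fun x => - g x).
Proof.
move=> oW Cg; apply: eq_ckon oW _ (ckonM oW (ckon_cst r W (-1)) Cg) => x _ /=.
by rewrite mulN1r.
Qed.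

Lemma ckonB r W g h : open W -> ckon r W g -> ckon r W h ->
  ckon r W (fun x => g x - h x).
Proof. by move=> oW Cg Ch; apply: ckonD => //; exact: ckonN. Qed.

Lemma ckon_sum r W (J : Type) (s : seq J) (F : J -> V -> R) : open W ->
  (forall j, ckon r W (F j)) -> ckon r W (fun x => \sum_(j <- s) F j x).
Proof.
move=> oW CF; elim: s => [|j s IH].
  by apply: eq_ckon oW _ (ckon_cst r W 0) => x _; rewrite big_nil.
by apply: eq_ckon oW _ (ckonD oW (CF j) IH) => x _; rewrite big_cons.
Qed.

Lemma ckon_prod r W (J : Type) (s : seq J) (F : J -> V -> R) : open W ->
  (forall j, ckon r W (F j)) -> ckon r W (fun x => \prod_(j <- s) F j x).
Proof.
move=> oW CF; elim: s => [|j s IH].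
  by apply: eq_ckon oW _ (ckon_cst r W 1) => x _; rewrite big_nil.
by apply: eq_ckon oW _ (ckonM oW (CF j) IH) => x _; rewrite big_cons.
Qed.

(** Meant for coordinate functions: after one derivative only constants are left. *)
Lemma ckon_affine r W g : continuous g ->
  (forall j, exists c, forall x, is_derive x (e j) g c) -> ckon r W g.
Proof.
move=> cg dg; case: r => [|r]; (split; first by move=> x _; exact: cg) => // j.
have [c dc] := dg j; split=> [x _|]; first by case: (dc x).
have -> : 'D_(e j) g = cst c by apply/funext => x; have [_ ->] := dc x.
exact: ckon_cst.
Qed.

(** The head of the list is the derivative taken last, as in [partials]. *)
Fixpoint dpart (s : seq I) g : V -> R :=
  if s is j :: s' then 'D_(e j) (dpart s' g) else g.

Lemma dpart_rcons s j g : dpart (rcons s j) g = dpart s ('D_(e j) g).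
Proof. by elim: s => //= i s ->. Qed.

Lemma smooth_derive W g j : smooth W g -> smooth W ('D_(e j) g).
Proof. by move=> Cg r; have [_ /(_ j)[]] := Cg r.+1. Qed.

Lemma smooth_dpart W g s : smooth W g -> smooth W (dpart s g).
Proof. by move=> Cg; elim: s => //= j s; exact: smooth_derive. Qed.

Lemma smooth_derivable W g j x : smooth W g -> W x -> derivable g x (e j).
Proof. by move=> /(_ 1%N)[_ /(_ j)[+ _]]; exact. Qed.

Lemma smooth_continuous W g x : smooth W g -> W x -> {for x, continuous g}.
Proof. by move=> /(_ 0); exact: ckon_continuous. Qed.

(** Passes between the recursive form, suited to induction on the order, and the pointwise form in
    which [smooth_on] is phrased. *)
Lemma smoothP W g : smooth W g <-> forall s x, W x ->
  {for x, continuous (dpart s g)} /\ forall j, derivable (dpart s g) x (e j).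
Proof.
split=> [Cg s x Wx|H r].
  have Cs := smooth_dpart s Cg; split; first exact: smooth_continuous Wx.
  by move=> j; exact: smooth_derivable Wx.
elim: r g H => [|r IH] g H; (split; first by move=> x /(H [::])[]) => //.
move=> j; split; first by move=> x /(H [::])[].
by apply: IH => s x; rewrite -dpart_rcons; exact: H.
Qed.

Lemma eq_dpart W g h s x : open W -> (forall x, W x -> g x = h x) -> W x ->
  dpart s g x = dpart s h x.
Proof.
move=> oW gh; elim: s x => [|j s IH] x Wx /=; first exact: gh.
apply: near_eq_derive; near=> y; apply: IH; near: y.
exact: open_nbhs_nbhs.
Unshelve. all: by end_near. Qed.

End DirectionalSmoothness.

(** * Mean value theorem on lines and symmetry of mixed derivatives *)

Section MixedPartials.
Variables (R : realType) (V : normedModType R).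
Implicit Types (g : V -> R) (u v : V).

Lemma is_derive_line g u x (t : R) : derivable g (t *: u + x) u ->
  is_derive t 1 (fun t => g (t *: u + x)) ('D_u g (t *: u + x)).
Proof.
have E : (fun h : R => h^-1 *: (g ((h *: 1 + t) *: u + x) - g (t *: u + x)))
   = (fun h : R => h^-1 *: (g (h *: u + (t *: u + x)) - g (t *: u + x))).
  by apply/funext => h; rewrite /= [h *: 1]mulr1 scalerDl addrA.
move=> dg; apply: DeriveDef; first by rewrite /derivable /= E.
by rewrite /derive /= E.
Qed.

Lemma MVT_line g u x (a b : R) : a < b ->
  (forall t, t \in `[a, b]%R -> derivable g (t *: u + x) u) ->
  exists2 c, c \in `]a, b[%R &
    g (b *: u + x) - g (a *: u + x) = 'D_u g (c *: u + x) * (b - a).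
Proof.
move=> ab dg.
have dl t : t \in `[a, b]%R ->
    is_derive t 1 (fun t => g (t *: u + x)) ('D_u g (t *: u + x)).
  by move=> /dg; exact: is_derive_line.
have dl' t : t \in `]a, b[%R ->
    is_derive t 1 (fun t => g (t *: u + x)) ('D_u g (t *: u + x)).
  rewrite in_itv /= => /andP[ta tb].
  by apply: dl; rewrite in_itv /= (ltW ta) (ltW tb).
have cl : {within `[a, b], continuous (fun t => g (t *: u + x))}.
  by apply: derivable_within_continuous => t /dl[].
have [c cab E] := MVT ab dl' cl.
by exists c.
Qed.

End MixedPartials.

Section SecondDifference.
Variables (R : realType) (V : normedModType R).
Implicit Types (g : V -> R) (u v x w : V).

Lemma derivable_translate g u w x : derivable g (w + x) u ->
  derivable (fun y => g (w + y)) x u.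
Proof.
rewrite /derivable; set F := (F in cvg (F @ _) -> _); set G := (G in _ -> cvg (G @ _)).
by have -> : G = F by apply/funext => h; rewrite /F /G /= addrCA.
Qed.

Lemma derive_translate g u w x :
  'D_u (fun y => g (w + y)) x = 'D_u g (w + x).
Proof.
rewrite /derive; set F := (F in lim (F @ _) = _); set G := (G in _ = lim (G @ _)).
by have -> : F = G by apply/funext => h; rewrite /F /G /= addrCA.
Qed.

(** The left side is an increment along u of y |-> g (h v + y) - g y. The mean value theorem along u
    turns it into an increment of 'D_u g along v, to which the theorem applies again. *)
Lemma second_difference g u v x (h : R) : 0 < h ->
  (forall s t, s \in `[0, h]%R -> t \in `[0, h]%R ->
    derivable g (t *: v + (s *: u + x)) u) ->
  (forall s t, s \in `[0, h]%R -> t \in `[0, h]%R ->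
    derivable ('D_u g) (t *: v + (s *: u + x)) v) ->
  exists s t, [/\ s \in `[0, h]%R, t \in `[0, h]%R &
    g (h *: v + (h *: u + x)) - g (h *: u + x) - g (h *: v + x) + g x =
    'D_v ('D_u g) (t *: v + (s *: u + x)) * h ^+ 2].
Proof.
move=> h0 du dvu.
pose k y := g (h *: v + y) - g y.
have i0 : 0 \in `[0, h]%R by rewrite in_itv /= lexx ltW.
have ih : h \in `[0, h]%R by rewrite in_itv /= lexx ltW.
have dg s : s \in `[0, h]%R -> derivable g (s *: u + x) u.
  by move=> si; have := du s 0 si i0; rewrite scale0r add0r.
have dgh s : s \in `[0, h]%R ->
    derivable (fun y => g (h *: v + y)) (s *: u + x) u.
  by move=> si; apply: derivable_translate; exact: du.
have [|s si Es] := @MVT_line R V k u x 0 h h0.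
  by move=> s si; apply: derivableB; [exact: dgh|exact: dg].
have si' : s \in `[0, h]%R.
  by move: si; rewrite !in_itv /= => /andP[/ltW -> /ltW ->].
have [|t ti Et] := @MVT_line R V ('D_u g) v (s *: u + x) 0 h h0.
  by move=> t ti; exact: dvu.
have ti' : t \in `[0, h]%R.
  by move: ti; rewrite !in_itv /= => /andP[/ltW -> /ltW ->].
exists s, t; split => //.
have Dk : 'D_u k (s *: u + x)
    = 'D_u g (h *: v + (s *: u + x)) - 'D_u g (s *: u + x).
  by rewrite deriveB ?derive_translate//; [exact: dgh|exact: dg].
move: Es Et; rewrite Dk /k !scale0r !add0r subr0 => Es Et.
rewrite expr2 mulrA -Et -Es; ring.
Qed.

(** The second difference is symmetric in u and v. Computed in both orders, it gives one number that
    is a value of each mixed derivative at a point close to x; continuity at x does the rest. *)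
Lemma mixed_partials g u v x :
  (\forall y \near x, derivable g y u /\ derivable ('D_u g) y v) ->
  (\forall y \near x, derivable g y v /\ derivable ('D_v g) y u) ->
  {for x, continuous ('D_v ('D_u g))} -> {for x, continuous ('D_u ('D_v g))} ->
  'D_v ('D_u g) x = 'D_u ('D_v g) x.
Proof.
move=> nu nv cuv cvu; apply/eqP; rewrite -subr_eq0 -normr_le0.
apply/ler_addgt0Pl => eps eps0; rewrite addr0.
have eps20 : 0 < eps / 2 by rewrite divr_gt0.
have n1 : \forall y \near x, `|'D_v ('D_u g) x - 'D_v ('D_u g) y| < eps / 2.
  by move/cvgrPdist_lt : cuv => /(_ _ eps20).
have n2 : \forall y \near x, `|'D_u ('D_v g) x - 'D_u ('D_v g) y| < eps / 2.
  by move/cvgrPdist_lt : cvu => /(_ _ eps20).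
have n3 : \forall y \near x,
    ((derivable g y u /\ derivable ('D_u g) y v) /\
     (derivable g y v /\ derivable ('D_v g) y u)) /\
    (`|'D_v ('D_u g) x - 'D_v ('D_u g) y| < eps / 2 /\
     `|'D_u ('D_v g) x - 'D_u ('D_v g) y| < eps / 2).
  exact: filterI (filterI nu nv) (filterI n1 n2).
have [d /= d0 Hd] := (nbhs_ballP _ _).1 n3.
(* With this h the parallelogram spanned by h u and h v at x lies in the ball of radius d; the 1
   keeps the denominator positive. *)
pose h := d / (2 * (`|u| + `|v| + 1)).
have p0 : 0 < `|u| + `|v| + 1 by rewrite ltr_wpDl// addr_ge0.
have h0 : 0 < h by rewrite divr_gt0// mulr_gt0.
have bx (a b : V) s t : `|a| + `|b| = `|u| + `|v| -> s \in `[0, h]%R ->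
    t \in `[0, h]%R -> ball x d (t *: b + (s *: a + x)).
  move=> ab; rewrite !in_itv /= => /andP[s0 sh] /andP[t0 th].
  rewrite -ball_normE /ball_ /= distrC.
  have -> : t *: b + (s *: a + x) - x = t *: b + s *: a by rewrite addrA addrK.
  rewrite (le_lt_trans (ler_normD _ _))// !normrZ !ger0_norm//.
  apply: (@le_lt_trans _ _ (h * (`|a| + `|b|))).
    by rewrite mulrDr addrC lerD// ler_wpM2r.
  rewrite ab /h mulrAC ltr_pdivrMr ?mulr_gt0// ltr_pM2l//.
  have : 0 <= `|u| + `|v| by rewrite addr_ge0.
  by lra.
have [s [t [si ti E1]]] : exists s t, [/\ s \in `[0, h]%R, t \in `[0, h]%R &
    g (h *: v + (h *: u + x)) - g (h *: u + x) - g (h *: v + x) + g x =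
    'D_v ('D_u g) (t *: v + (s *: u + x)) * h ^+ 2].
  apply: (second_difference h0) => s t si ti.
    by have [[[H _] _] _] := Hd _ (bx u v s t erefl si ti).
  by have [[[_ H] _] _] := Hd _ (bx u v s t erefl si ti).
have [s' [t' [si' ti' E2]]] : exists s t, [/\ s \in `[0, h]%R, t \in `[0, h]%R &
    g (h *: u + (h *: v + x)) - g (h *: v + x) - g (h *: u + x) + g x =
    'D_u ('D_v g) (t *: u + (s *: v + x)) * h ^+ 2].
  apply: (second_difference h0) => s' t' si' ti'.
    by have [[_ [H _]] _] := Hd _ (bx v u s' t' (addrC _ _) si' ti').
  by have [[_ [_ H]] _] := Hd _ (bx v u s' t' (addrC _ _) si' ti').
have [_ [h1 _]] := Hd _ (bx u v s t erefl si ti).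
have [_ [_ h2]] := Hd _ (bx v u s' t' (addrC _ _) si' ti').
move: E1 E2 h1 h2; rewrite (addrCA (h *: u)).
move: ('D_v ('D_u g) (t *: v + _)) ('D_u ('D_v g) (t' *: u + _)) => A B.
move: ('D_v ('D_u g) x) ('D_u ('D_v g) x) => A0 B0.
move: (g _) (g (h *: u + x)) (g (h *: v + x)) (g x) => z1 z2 z3 z4 E1 E2.
have E : A = B.
  apply: (mulIf (x := h ^+ 2)); first by rewrite expf_neq0// gt_eqF.
  by rewrite -E1 -E2; ring.
rewrite -E [`|B0 - A|]distrC => h1 h2.
apply: le_trans (ler_distD A A0 B0) _.
by rewrite (splitr eps) lerD// ltW.
Qed.

End SecondDifference.

Section SymmetricPartials.
Variables (R : realType) (V : normedModType R) (I : eqType) (e : I -> V).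
Implicit Types (g : V -> R) (W : set V).

Lemma dpart_swap W g i j x : open W -> smooth e W g -> W x ->
  'D_(e i) ('D_(e j) g) x = 'D_(e j) ('D_(e i) g) x.
Proof.
move=> oW Cg Wx; have nW : nbhs x W by exact: open_nbhs_nbhs.
apply: mixed_partials.
- near=> y; have Wy : W y by near: y.
  split; first exact: smooth_derivable Cg Wy.
  exact: smooth_derivable (smooth_derive j Cg) Wy.
- near=> y; have Wy : W y by near: y.
  split; first exact: smooth_derivable Cg Wy.
  exact: smooth_derivable (smooth_derive i Cg) Wy.
- exact: smooth_continuous (smooth_derive i (smooth_derive j Cg)) Wx.
- exact: smooth_continuous (smooth_derive j (smooth_derive i Cg)) Wx.
Unshelve. all: by end_near. Qed.

(** Strong neighbourhoods control only the sorted lists of [multi_partial], while the calculus of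
    [dpart] produces lists in any order. The head of s is moved to its place in t by successive
    swaps. *)
Lemma dpart_perm W g s t x : open W -> smooth e W g -> W x -> perm_eq s t ->
  dpart e s g x = dpart e t g x.
Proof.
move=> oW Cg; elim: s t x => [|j s IH] t x Wx.
  by move=> pst; have := perm_size pst; case: t {pst}.
move=> pst; have jt : j \in t by rewrite -(perm_mem pst) mem_head.
have [t1 [t2 Et]] : exists t1 t2, t = t1 ++ j :: t2.
  by case/splitPr: jt => t1 t2; exists t1, t2.
have pst' : perm_eq s (t1 ++ t2).
  rewrite -(perm_cons j) (perm_trans pst)// Et.
  by rewrite -cat1s perm_catCA.
have E1 : dpart e (j :: s) g x = dpart e (j :: t1 ++ t2) g x.
  apply: near_eq_derive; near=> y; apply: IH => //; near: y.
  exact: open_nbhs_nbhs.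
rewrite E1 Et {IH pst pst' E1 Et jt t s}; elim: t1 x Wx => //= i t1 IH x Wx.
rewrite (dpart_swap j i oW (smooth_dpart (t1 ++ t2) Cg) Wx).
apply: near_eq_derive; near=> y; apply: IH; near: y.
exact: open_nbhs_nbhs.
Unshelve. all: by end_near. Qed.

End SymmetricPartials.

(** * Chain rule for C^r functions of several variables *)

Section PartialDerivatives.
Variables (R : realType).

Definition dirs n (j : 'I_n) : 'rV[R]_n := delta_mx 0 j.

Definition dir1 (_ : unit) : R := 1.

Lemma continuous_rV (T : topologicalType) n (G : T -> 'rV[R]_n) x :
  (forall i, {for x, continuous (fun y => G y 0 i)}) -> {for x, continuous G}.
Proof.
move=> cG; apply/cvgrPdist_lt => eps eps0.
have H : \forall y \near x, forall i, `|G x 0 i - G y 0 i| < eps.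
  by apply: filter_forall => i; move/cvgrPdist_lt : (cG i) => /(_ _ eps0).
near=> y; have Hy : forall i, `|G x 0 i - G y 0 i| < eps by near: y.
rewrite [ltLHS]/Num.Def.normr/= mx_normrE; apply/bigmax_ltP; split=> // -[i j] _ /=.
by rewrite !mxE ord1.
Unshelve. all: by end_near. Qed.

Lemma continuous_entry (T : topologicalType) n (G : T -> 'rV[R]_n) x i :
  {for x, continuous G} -> {for x, continuous (fun y => G y 0 i)}.
Proof.
move=> cG; apply: (@continuous_comp _ _ _ G (fun v : 'rV[R]_n => v 0 i)) => //.
exact: coord_continuous.
Qed.

Lemma ball_rV n (x y : 'rV[R]_n) d : 0 < d ->
  ball x d y <-> forall i, `|x 0 i - y 0 i| < d.
Proof.
move=> d0; split=> [[_ H] i|H]; first exact: H.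
by split=> // i j; rewrite ord1; exact: H.
Qed.

(** The step t may have either sign or vanish; for t = 0 the point c is the endpoint 0, hence the
    weak inequalities. *)
Lemma MVT_line_between (V : normedModType R) (g : V -> R) u x (t : R) :
  let between s := (0 <= s <= t) || (t <= s <= 0) in
  (forall s, between s -> derivable g (s *: u + x) u) ->
  exists2 c, between c & g (t *: u + x) - g x = 'D_u g (c *: u + x) * t.
Proof.
move=> between dg; have [t0|t0|t0] := ltrgt0P t.
- have [|c] := @MVT_line R V g u x 0 t t0.
    by move=> s; rewrite in_itv /= => st; apply: dg; rewrite /between st.
  rewrite in_itv /= => /andP[/ltW c0 /ltW ct].
  rewrite scale0r add0r subr0 => E; exists c => //.
  by rewrite /between c0 ct.
- have [|c] := @MVT_line R V g u x t 0 t0.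
    by move=> s; rewrite in_itv /= => st; apply: dg; rewrite /between st orbT.
  rewrite in_itv /= => /andP[/ltW c0 /ltW ct].
  rewrite scale0r add0r sub0r => E; exists c; first by rewrite /between c0 ct orbT.
  by apply: oppr_inj; rewrite opprB E mulrN.
- exists 0; first by rewrite /between t0 lexx.
  by rewrite t0 !scale0r !add0r subrr mulr0.
Qed.

(** Go from a to b by changing one coordinate at a time and telescope. Balls of the sup norm are
    boxes, so the broken path does not leave the ball. *)
Lemma MVT_coords n (g : 'rV[R]_n -> R) x d a b : 0 < d ->
  ball x d a -> ball x d b ->
  (forall y j, ball x d y -> derivable g y (dirs j)) ->
  exists2 xi : 'I_n -> 'rV[R]_n, (forall j, ball x d (xi j)) &
    g b - g a = \sum_j 'D_(dirs j) g (xi j) * (b 0 j - a 0 j).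
Proof.
move=> d0 Ba Bb dg.
pose mix k := \row_(i < n) (if (i < k)%N then b 0 i else a 0 i).
have Bmix k (y : 'rV[R]_n) : (forall i, `|x 0 i - y 0 i| < d \/ y 0 i = mix k 0 i) ->
    ball x d y.
  move=> H; apply/ball_rV => // i; have [//|->] := H i.
  by rewrite mxE; case: ifP => _; [move/ball_rV: Bb|move/ball_rV: Ba]; exact.
have step (j : 'I_n) : exists y : 'rV[R]_n, ball x d y /\
    g (mix j.+1) - g (mix j) = 'D_(dirs j) g y * (b 0 j - a 0 j).
  have Bl s : (0 <= s <= b 0 j - a 0 j) || (b 0 j - a 0 j <= s <= 0) ->
      ball x d (s *: dirs j + mix j).
    move=> ss; apply: (Bmix j) => i; rewrite !mxE eqxx /=.
    have [->|ij] := eqVneq i j; last by right; rewrite mulr0 add0r.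
    left; rewrite mulr1 ltnn.
    have /ball_rV -/(_ d0 j) := Ba; have /ball_rV -/(_ d0 j) := Bb.
    move: (x 0 j) (a 0 j) (b 0 j) ss => xj aj bj.
    by rewrite !ltr_norml => /orP[/andP[s1 s2]|/andP[s1 s2]]
      /andP[h1 h2] /andP[h3 h4]; apply/andP; split; lra.
  have -> : mix j.+1 = (b 0 j - a 0 j) *: dirs j + mix j.
    apply/rowP => i; rewrite !mxE eqxx /=.
    have [->|ij] := eqVneq i j; first by rewrite ltnSn ltnn mulr1 subrK.
    by rewrite mulr0 add0r ltnS leq_eqVlt -[(i == j :> nat)]/(i == j) (negPf ij).
  have [|c cb E] := @MVT_line_between _ g (dirs j) (mix j) (b 0 j - a 0 j).
    by move=> s /Bl; exact: dg.
  by exists (c *: dirs j + mix j); split=> //; exact: Bl.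
have [xi Hxi] := choice step.
exists xi; first by move=> j; have [] := Hxi j.
have -> : g b = g (mix n).
  by congr g; apply/rowP => i; rewrite mxE ltn_ord.
have -> : g a = g (mix 0%N).
  by congr g; apply/rowP => i; rewrite mxE ltn0.
rewrite -(telescope_sumr (fun k => g (mix k)))// big_mkord.
by apply: eq_bigr => j _; have [] := Hxi j.
Qed.

(** Continuous partial derivatives give differentiability: in [MVT_coords] the derivatives at the
    points xi j differ by less than eps from those at x. *)
Lemma C1_estimate n (W : set 'rV[R]_n) (g : 'rV[R]_n -> R) x eps :
  open W -> ckon (@dirs n) 1 W g -> W x -> 0 < eps ->
  \forall y \near x, `|g y - g x - \sum_j 'D_(dirs j) g x * (y 0 j - x 0 j)|
    <= eps * \sum_j `|y 0 j - x 0 j|.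
Proof.
move=> oW [_ Cg] Wx eps0.
have nW : nbhs x W by exact: open_nbhs_nbhs.
have H2 : \forall y \near x,
    forall j, `|'D_(dirs j) g x - 'D_(dirs j) g y| < eps.
  apply: (@filter_forall _ _
    (fun j y => `|'D_(dirs j) g x - 'D_(dirs j) g y| < eps)
    _ (nbhs_filter x)) => j; have [_ [+ _]] := Cg j.
  by move=> /(_ x Wx) /cvgrPdist_lt /(_ _ eps0).
have Hn : \forall y \near x, W y /\
    forall j, `|'D_(dirs j) g x - 'D_(dirs j) g y| < eps.
  exact: filterI nW H2.
have [d /= d0 Hd] := (nbhs_ballP _ _).1 Hn.
apply/nbhs_ballP; exists d => //= y By.
have dgj z j : ball x d z -> derivable g z (dirs j).
  by move=> /Hd[Wz _]; have [+ _] := Cg j; exact.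
have [xi Bxi ->] := MVT_coords d0 (ballxx x d0) By dgj.
rewrite -sumrB mulr_sumr (le_trans (ler_norm_sum _ _ _))//.
apply: ler_sum => j _; rewrite -mulrBl normrM ler_wpM2r//.
by have [_ /(_ j)] := Hd _ (Bxi j); rewrite distrC => /ltW.
Qed.

(** The inner map is only known to have a derivative in the direction v, so the difference quotient
    of g \o G is compared directly with the linear part of g applied to the quotients q i of G. *)
Lemma derive_comp n (V : normedModType R) (W : set 'rV[R]_n)
    (g : 'rV[R]_n -> R) (G : V -> 'rV[R]_n) x v :
  open W -> ckon (@dirs n) 1 W g -> W (G x) -> {for x, continuous G} ->
  (forall i, derivable (fun y => G y 0 i) x v) ->
  is_derive x v (g \o G)
    (\sum_i 'D_(dirs i) g (G x) * 'D_v (fun y => G y 0 i) x).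
Proof.
move=> oW Cg WGx cG dG.
set L := \sum_i _.
suff H : h^-1 *: ((g \o G) (h *: v + x) - (g \o G) x) @[h --> 0^'] --> L.
  apply: DeriveDef; first by apply/cvg_ex; exists L.
  exact/cvg_lim.
pose q i (h : R) := h^-1 *: (G (h *: v + x) 0 i - G x 0 i).
have cq i : q i h @[h --> 0^'] --> 'D_v (fun y => G y 0 i) x.
  by have := dG i; rewrite /derivable => /cvg_toP; apply.
have cL : \sum_i ('D_(dirs i) g (G x) * q i h) @[h --> 0^'] --> L.
  by apply: cvg_big => [|i _]; [exact: add_continuous|apply: cvgMl_tmp; exact: cq].
have cQ : \sum_i `|q i h| @[h --> 0^'] -->
    \sum_i `|'D_v (fun y => G y 0 i) x|.
  by apply: cvg_big => [|i _]; [exact: add_continuous|apply: cvg_norm; exact: cq].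
set Q := \sum_i `|'D_v (fun y => G y 0 i) x| in cQ.
have Q0 : 0 <= Q by apply: sumr_ge0.
apply/cvgrPdist_lt => eps eps0.
(* Q + 1 eventually bounds the sum of the [|q i h|], so an error of eps / 2 / (Q + 1) in
   [C1_estimate] costs at most eps / 2 after division by h. *)
have Qp : 0 < Q + 1 by rewrite ltr_wpDl.
have eps1 : 0 < eps / 2 / (Q + 1) by rewrite !divr_gt0.
have E1 := C1_estimate oW Cg WGx eps1.
have E2 : \forall h \near (0 : R)^', `|g (G (h *: v + x)) - g (G x) -
   \sum_j 'D_(dirs j) g (G x) * (G (h *: v + x) 0 j - G x 0 j)|
    <= eps / 2 / (Q + 1) * \sum_j `|G (h *: v + x) 0 j - G x 0 j|.
  have c1 : G (h *: v + x) @[h --> (0 : R)^'] --> G x.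
    have c0 : h *: v + x @[h --> (0 : R)] --> x.
      rewrite -[X in _ --> X]add0r -[X in _ --> X + _](scale0r v).
      by apply: cvgD; [apply: cvgZr_tmp; exact: cvg_id|exact: cvg_cst].
    have c2 : h *: v + x @[h --> (0 : R)^'] --> x.
      by apply: cvg_trans c0; apply: cvg_app; exact: cvg_within.
    exact: cvg_comp c2 cG.
  exact: c1 _ E1.
have E3 : \forall h \near (0 : R)^', \sum_i `|q i h| < Q + 1.
  by apply: (cvgr_lt Q) => //; rewrite ltrDl.
have E4 : \forall h \near (0 : R)^',
    `|L - \sum_i ('D_(dirs i) g (G x) * q i h)| < eps / 2.
  by move/cvgrPdist_lt : cL; apply; rewrite divr_gt0.
have E5 : \forall h \near (0 : R)^', h != 0 :> R by exact: nbhs_dnbhs_neq.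
near=> h.
have h0 : h != 0 by near: h.
have e2 : `|g (G (h *: v + x)) - g (G x) -
   \sum_j 'D_(dirs j) g (G x) * (G (h *: v + x) 0 j - G x 0 j)|
    <= eps / 2 / (Q + 1) * \sum_j `|G (h *: v + x) 0 j - G x 0 j| by near: h.
have e3 : \sum_i `|q i h| < Q + 1 by near: h.
have e4 : `|L - \sum_i ('D_(dirs i) g (G x) * q i h)| < eps / 2 by near: h.
have EL : \sum_i ('D_(dirs i) g (G x) * q i h) = h^-1 *
    \sum_j 'D_(dirs j) g (G x) * (G (h *: v + x) 0 j - G x 0 j).
  by rewrite mulr_sumr; apply: eq_bigr => i _; rewrite mulrCA.
have E6 : \sum_i `|q i h| = `|h^-1| *
    \sum_j `|G (h *: v + x) 0 j - G x 0 j|.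
  by rewrite mulr_sumr; apply: eq_bigr => i _; rewrite normrM.
rewrite E6 in e3; rewrite EL in e4.
move: e2 e3 e4; rewrite /=.
move: (\sum_j `|G (h *: v + x) 0 j - G x 0 j|) => S.
move: (\sum_j 'D_(dirs j) g (G x) * _) => T.
move: (g (G (h *: v + x)) - g (G x)) => D e2 e3 e4.
rewrite [_ *: _]/(_ * _) (le_lt_trans (ler_distD (h^-1 * T) _ _))//.
rewrite [ltRHS]splitr ltr_leD// -mulrBr normrM distrC.
apply: (@le_trans _ _ (`|h^-1| * (eps / 2 / (Q + 1) * S))).
  by rewrite ler_wpM2l.
rewrite mulrCA -[leRHS](divfK (x := Q + 1)) ?gt_eqF// ler_wpM2l// ?ltW//.
Unshelve. all: by end_near. Qed.

(** By the chain rule each derivative of g \o G is a sum of products of some 'D_i g \o G with a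
    derivative of an entry of G, all of one order less; hence an induction on r with g varying. *)
Lemma ckon_comp n (V : normedModType R) (I : Type) (e : I -> V) r
    (W' : set 'rV[R]_n) (W : set V) (g : 'rV[R]_n -> R) (G : V -> 'rV[R]_n) :
  open W' -> open W -> (forall x, W x -> W' (G x)) ->
  ckon (@dirs n) r W' g -> (forall i, ckon e r W (fun x => G x 0 i)) ->
  ckon e r W (g \o G).
Proof.
move=> oW' oW GW; elim: r g => [|r IH] g Cg CG.
  split=> // x Wx; apply: continuous_comp; last first.
    exact: ckon_continuous Cg (GW _ Wx).
  by apply: continuous_rV => i; exact: ckon_continuous (CG i) Wx.
have cG x : W x -> {for x, continuous G}.
  by move=> Wx; apply: continuous_rV => i; exact: ckon_continuous (CG i) Wx.
have C1 : ckon (@dirs n) 1 W' g.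
  case: Cg => cg dg; split=> // j; have [dgj dg'] := dg j; split=> //.
  by split=> // x W'x; exact: ckon_continuous dg' W'x.
have dgG x j : W x -> is_derive x (e j) (g \o G)
    (\sum_i 'D_(dirs i) g (G x) * 'D_(e j) (fun y => G y 0 i) x).
  move=> Wx; apply: (derive_comp oW' C1 (GW _ Wx) (cG _ Wx)) => i.
  by have [_ /(_ j)[+ _]] := CG i; exact.
split=> [x Wx|j].
  apply: continuous_comp; first exact: cG.
  exact: ckon_continuous Cg (GW _ Wx).
split=> [x Wx|]; first by case: (dgG x j Wx).
apply: (@eq_ckon _ _ _ _ _ _ (fun x => \sum_(i <- index_enum 'I_n)
   ('D_(dirs i) g \o G) x * 'D_(e j) (fun y => G y 0 i) x)) => //.
  by move=> x Wx; rewrite (@derive_val _ _ _ _ _ _ _ (dgG x j Wx)).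
apply: ckon_sum => // i; apply: ckonM => //.
  apply: IH => [|k]; last exact: ckonS (CG k).
  by have [_ /(_ i)[_]] := Cg.
by have [_ /(_ j)[_]] := CG i.
Qed.

Lemma derive_line (V : normedModType R) (g : V -> R) x v :
  'D_v g x = 'D_1 (fun h : R => g (h *: v + x)) 0.
Proof.
rewrite /derive; set F := (F in lim (F @ _) = _); set G := (G in _ = lim (G @ _)).
have -> : F = G by apply/funext => h; rewrite /F /G /= addr0 [h *: 1]mulr1 scale0r add0r.
by [].
Qed.

(** Separate from [ckon_comp] because the outer function lives on R and not on row vectors;
    restricted to lines, it is the chain rule in one variable. *)
Lemma ckon_comp1 (V : normedModType R) (J : Type) (e : J -> V) r
    (W : set V) (g : R -> R) (u : V -> R) :
  open W -> ckon dir1 r setT g -> ckon e r W u ->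
  ckon e r W (g \o u).
Proof.
move=> oW; elim: r g => [|r IH] g Cg Cu.
  split=> // x Wx; apply: continuous_comp.
    exact: ckon_continuous Cu Wx.
  exact: (@ckon_continuous _ _ _ _ _ _ _ (u x) Cg Logic.I).
have dgu x j : W x -> is_derive x (e j) (g \o u)
    ('D_1 g (u x) * 'D_(e j) u x).
  move=> Wx; have [_ /(_ tt)[dg _]] := Cg; have [_ /(_ j)[du _]] := Cu.
  set v := e j.
  have dux : derivable (fun h : R => u (h *: v + x)) 0 1.
    exact: (derivable1P u x v).1 (du x Wx).
  have dgx : derivable g ((fun h : R => u (h *: v + x)) 0) 1.
    exact: dg.
  apply: DeriveDef.
    apply/(derivable1P (g \o u))/derivable1_diffP.
    apply: (@differentiable_comp _ _ _ _ (fun h : R => u (h *: v + x)) g).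
      exact: (derivable1_diffP _ _).1 dux.
    exact: (derivable1_diffP _ _).1 dgx.
  rewrite (derive_line (g \o u)) (derive_line u).
  have := derive1_comp dux dgx; rewrite !derive1E /= scale0r add0r => <-.
  by [].
split=> [x Wx|j].
  apply: continuous_comp; first exact: ckon_continuous Cu Wx.
  exact: (@ckon_continuous _ _ _ _ _ _ _ (u x) Cg Logic.I).
split=> [x Wx|]; first by case: (dgu x j Wx).
apply: (@eq_ckon _ _ _ _ _ _ (fun x => ('D_1 g \o u) x * 'D_(e j) u x)) => //.
  by move=> x Wx; rewrite (@derive_val _ _ _ _ _ _ _ (dgu x j Wx)).
apply: ckonM => //; last by have [_ /(_ j)[_]] := Cu.
by apply: IH; [have [_ /(_ tt)[_]] := Cg|exact: ckonS].
Qed.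

End PartialDerivatives.

(** * Vector-valued smooth maps and their entries *)

Section SmoothOn.
Variables (R : realType) (m n : nat).
Implicit Types (g : 'rV[R]_m -> 'rV[R]_n) (W : set 'rV[R]_m).

(** The disjunction lets one induction serve both directions of [smooth_onP]: either alternative
    makes the iterated partials derivable, which is what differentiating entry by entry requires. *)
Lemma partials_row W g s x : open W -> W x ->
  (forall i, smooth (@dirs R m) W (fun y => g y 0 i)) \/ smooth_on W g ->
  partials s g x = \row_i dpart (@dirs R m) s (fun y => g y 0 i) x.
Proof.
move=> oW Wx Sg; elim: s x Wx => [|j s IH] x Wx /=.
  by apply/rowP => i; rewrite mxE.
have nIH : \forall y \near x,
    \row_i dpart (@dirs R m) s (fun y => g y 0 i) y = partials s g y.
  by near=> y; apply/esym/IH; near: y; exact: open_nbhs_nbhs.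
have dg : derivable (partials s g) x (delta_mx 0 j).
  case: Sg => [Sg|]; last by move=> /(_ s x Wx)[_]; exact.
  apply: near_eq_derivable nIH _; apply/derivable_mxP => k i.
  have -> : (fun y => (\row_i dpart (@dirs R m) s (fun y => g y 0 i) y) k i) =
     dpart (@dirs R m) s (fun y => g y 0 i) by apply/funext => y; rewrite mxE.
  exact: smooth_derivable (smooth_dpart s (Sg i)) Wx.
rewrite /partial derive_mx//; apply/rowP => i; rewrite !mxE.
apply: near_eq_derive; near=> y.
by rewrite IH ?mxE//; near: y; exact: open_nbhs_nbhs.
Unshelve. all: by end_near. Qed.

Lemma smooth_onP W g : open W ->
  smooth_on W g <-> forall i, smooth (@dirs R m) W (fun x => g x 0 i).
Proof.
move=> oW; split=> [Sg i|Sg s x Wx].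
  apply/smoothP => s x Wx.
  have nE : \forall y \near x, partials s g y 0 i =
      dpart (@dirs R m) s (fun y => g y 0 i) y.
    near=> y; rewrite (partials_row s oW) ?mxE//; last by right.
    by near: y; exact: open_nbhs_nbhs.
  have [cs ds] := Sg s x Wx; split=> [|j].
    rewrite /prop_for /continuous_at -(nbhs_singleton nE).
    apply: cvg_trans (continuous_entry (i := i) cs).
    exact: near_eq_cvg nE.
  by apply: near_eq_derivable nE _; exact: (derivable_mxP _ _ _).1 (ds j) 0 i.
have nE : \forall y \near x,
    \row_i dpart (@dirs R m) s (fun y => g y 0 i) y = partials s g y.
  near=> y; rewrite (partials_row s oW)//; last by left.
  by near: y; exact: open_nbhs_nbhs.
have E i : (fun y => (\row_i dpart (@dirs R m) s (fun y => g y 0 i) y) 0 i) =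
     dpart (@dirs R m) s (fun y => g y 0 i) by apply/funext => y; rewrite mxE.
split=> [|j].
  rewrite /prop_for /continuous_at -(nbhs_singleton nE).
  apply: cvg_trans (near_eq_cvg nE) _.
  apply: (@continuous_rV _ _ _
    (fun y => \row_i dpart (@dirs R m) s (fun y => g y 0 i) y)) => i.
  by rewrite E; exact: smooth_continuous (smooth_dpart s (Sg i)) Wx.
apply: near_eq_derivable nE _; apply/derivable_mxP => k i; rewrite ord1 E.
exact: smooth_derivable (smooth_dpart s (Sg i)) Wx.
Unshelve. all: by end_near. Qed.

Lemma multi_partial_dpart W g x (i : 'I_n) (a : 'I_m -> nat) : open W ->
  smooth_on W g -> W x ->
  multi_partial a g x 0 i = dpart (@dirs R m)
    (flatten [seq nseq (a j) j | j <- enum 'I_m]) (fun y => g y 0 i) x.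
Proof.
by move=> oW Sg Wx; rewrite /multi_partial (partials_row _ oW) ?mxE//; right.
Qed.

(** With [dpart_perm], this identifies the derivative along s with the one of the multi-index of
    multiplicities in s, whose order is [size s] by [sum_count_mem]. *)
Lemma perm_flatten_count (s : seq 'I_m) :
  perm_eq s (flatten [seq nseq (count_mem j s) j | j <- enum 'I_m]).
Proof.
apply/allP => k _ /=; apply/eqP.
rewrite count_flatten -!map_comp sumnE big_map.
under eq_bigr do rewrite /= count_nseq /=.
rewrite (bigD1_seq k) -?enumT ?mem_enum ?enum_uniq//=.
rewrite big1 ?addn0 => [|j /negPf].
  by rewrite ?eqxx ?mul1n.
by rewrite eq_sym => ->; rewrite mul0n.
Qed.

Lemma sum_count_mem (s : seq 'I_m) : (\sum_(j < m) count_mem j s)%N = size s.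
Proof.
by elim: s => [|k s IH] /=; [rewrite big1|rewrite big_split/= IH (bigD1 k)//= eqxx
  big1 ?addn0// => j /negPf; rewrite eq_sym => ->].
Qed.

End SmoothOn.

(** * Cutoff functions *)

Section FlatFunction.
Variable R : realType.
Implicit Types (t : R) (a : nat).

(** The exponent a makes the family stable under differentiation up to linear combinations, so one
    induction proves all members smooth. The classical flat function is a = 0. *)
Definition flat a t : R := if 0 < t then t^-1 ^+ a * expR (- t^-1) else 0.

Lemma flat_pos a t : 0 < t -> flat a t = t^-1 ^+ a * expR (- t^-1).
Proof. by rewrite /flat => ->. Qed.

Lemma flat_npos a t : t <= 0 -> flat a t = 0.
Proof. by rewrite /flat leNgt => /negbTE ->. Qed.

Lemma flat_ge0 a t : 0 <= flat a t.
Proof.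
by rewrite /flat; case: ifP => // t0; rewrite mulr_ge0 ?expR_ge0// exprn_ge0// invr_ge0 ltW.
Qed.

(** From exp x >= x^(a+2) / (a+2)! at x = 1/t. The exponent 2 leaves a factor |h| in the difference
    quotient at 0, which therefore tends to 0. *)
Lemma flat_le a t : `|flat a t| <= (a.+2)`!%:R * t ^+ 2.
Proof.
rewrite ger0_norm ?flat_ge0//; have [t0|t0] := leP t 0.
  by rewrite flat_npos// mulr_ge0// ?sqr_ge0.
rewrite flat_pos// expRN.
have /ltW ti0 : 0 < t^-1 by rewrite invr_gt0.
have := expR_ge1Dxn a.+1 ti0.
have F0 : 0 < (a.+2)`!%:R :> R by rewrite ltr0n fact_gt0.
move=> H; rewrite ler_pdivrMr ?expR_gt0//.
apply: (@le_trans _ _ ((a.+2)`!%:R * t ^+ 2 * (t^-1 ^+ a.+2 / (a.+2)`!%:R))).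
  rewrite !exprS; move: (t^-1 ^+ a) => z.
  rewrite le_eqVlt; apply/orP; left; apply/eqP; field.
  by rewrite !gt_eqF.
apply: ler_wpM2l; first by rewrite mulr_ge0// sqr_ge0.
by apply: le_trans H; rewrite lerDr.
Qed.

Lemma is_derive_flat a t :
  is_derive t 1 (flat a) (flat a.+2 t - a%:R * flat a.+1 t).
Proof.
have [t0|t0|->] := ltrgt0P t.
- have nE : \forall s \near t, (fun s => s^-1 ^+ a * expR (- s^-1)) s = flat a s.
    near=> s; rewrite flat_pos//; near: s; exact: lt_nbhsr.
  apply: near_eq_is_derive nE _.
  have tn0 : t != 0 by rewrite gt_eqF.
  have dV : is_derive t 1 (fun s : R => s^-1) (- t^-1 ^+ 2).
    rewrite exprVn -[X in is_derive _ _ _ X]mulr1.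
    exact: (is_deriveV (f := id) tn0 (is_derive_id t 1)).
  have dN : is_derive t 1 (fun s : R => - s^-1) (t^-1 ^+ 2).
    by rewrite -[X in is_derive _ _ _ X]opprK; exact: is_deriveN.
  have dX : is_derive t 1 (fun s : R => s^-1 ^+ a) (a%:R * t^-1 ^+ a.-1 * - t^-1 ^+ 2).
    have -> : (fun s : R => s^-1 ^+ a) = (fun s : R => s^-1) ^+ a.
      by apply/funext => s; rewrite exprfctE.
    exact: is_deriveX.
  have dE : is_derive t 1 (fun s : R => expR (- s^-1)) (expR (- t^-1) * t^-1 ^+ 2).
    exact: (is_derive1_comp (f := expR) (g := fun s : R => - s^-1)).
  have dM := is_deriveM dX dE.
  apply: (is_derive_eq dM).
  have scaleE (x y : R) : x *: y = x * y by [].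
  by rewrite !flat_pos// !scaleE; case: a {dX dM} => [|a]; rewrite /= ?exprS; ring.
- have nE : \forall s \near t, cst 0 s = flat a s.
    by near=> s; rewrite flat_npos// ltW//; near: s; exact: lt_nbhsl.
  apply: near_eq_is_derive nE _.
  by rewrite !flat_npos ?ltW// mulr0 subr0; exact: is_derive_cst.
- rewrite !flat_npos// mulr0 subr0.
  have H : h^-1 *: (flat a (h *: 1 + 0) - flat a 0) @[h --> (0 : R)^'] --> (0 : R).
    apply/cvgrPdist_le => eps eps0; near=> h.
    have h0 : h != 0 by near: h; exact: nbhs_dnbhs_neq.
    rewrite sub0r normrN [h *: 1]mulr1 addr0 (flat_npos a (lexx 0)) subr0.
    rewrite normrM; apply: (@le_trans _ _ (`|h^-1| * ((a.+2)`!%:R * h ^+ 2))).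
      by rewrite ler_wpM2l// flat_le.
    rewrite -real_normK ?num_real// normfV expr2 mulrCA mulKf ?normr_eq0//.
    have F0 : 0 < (a.+2)`!%:R :> R by rewrite ltr0n fact_gt0.
    rewrite -ler_pdivlMl// ltW//; near: h.
    by apply: dnbhs0_lt; rewrite mulr_gt0// invr_gt0.
  apply: DeriveDef; first by apply/cvg_ex; exists 0.
  exact/cvg_lim.
Unshelve. all: by end_near. Qed.

Lemma ckon_flat r a : ckon (@dir1 R) r setT (flat a).
Proof.
elim: r a => [|r IH] a.
  split=> // t _; apply: differentiable_continuous; apply/derivable1_diffP.
  by case: (is_derive_flat a t).
split=> [t _|j].
  apply: differentiable_continuous; apply/derivable1_diffP.
  by case: (is_derive_flat a t).
split=> [t _|]; first by case: (is_derive_flat a t).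
apply: (eq_ckon openT (g := fun t => flat a.+2 t - a%:R * flat a.+1 t)).
  by move=> t _; rewrite (@derive_val _ _ _ _ _ _ _ (is_derive_flat a t)).
by apply: ckonB openT _ _ => //; apply: ckonM openT _ _ => //; exact: ckon_cst.
Qed.

(* Equal to 1 for s <= 0, where flat 0 s = 0, and to 0 for s >= 1, where the
   argument of the outer flat function is nonpositive. *)
Definition cutoff (s : R) : R := flat 0 (flat 0 1 - flat 0 s) / flat 0 (flat 0 1).

Lemma flat0_pos t : 0 < t -> 0 < flat 0 t.
Proof. by move=> t0; rewrite flat_pos// expr0 mul1r expR_gt0. Qed.

Lemma flat0_homo : {homo flat 0 : s t / s <= t}.
Proof.
move=> s t st; have [s0|s0] := leP s 0; first by rewrite flat_npos// flat_ge0.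
have t0 : 0 < t by exact: lt_le_trans st.
by rewrite !flat_pos// !expr0 !mul1r ler_expR lerN2 lef_pV2 ?posrE.
Qed.

Lemma cutoff_le0 s : s <= 0 -> cutoff s = 1.
Proof.
move=> s0; rewrite /cutoff (flat_npos 0 s0) subr0 divff// gt_eqF//.
by do 2 apply: flat0_pos.
Qed.

Lemma cutoff_ge1 s : 1 <= s -> cutoff s = 0.
Proof. by move=> s1; rewrite /cutoff flat_npos ?mul0r// subr_le0 flat0_homo. Qed.

Lemma cutoff_ge0 s : 0 <= cutoff s.
Proof. by rewrite /cutoff divr_ge0 ?flat_ge0. Qed.

Lemma cutoff_le1 s : cutoff s <= 1.
Proof.
have p : 0 < flat 0 (flat 0 1) by do 2 apply: flat0_pos.
by rewrite /cutoff ler_pdivrMr// mul1r flat0_homo// gerBl flat_ge0.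
Qed.

Lemma smooth_cutoff : smooth (@dir1 R) setT cutoff.
Proof.
move=> r; apply: ckonM openT _ _; last exact: ckon_cst.
apply: (ckon_comp1 (g := flat 0) (u := fun s => flat 0 1 - flat 0 s)) openT _ _.
  exact: ckon_flat.
by apply: ckonB openT _ _; [exact: ckon_cst|exact: ckon_flat].
Qed.

End FlatFunction.

(** * Gluing along disjoint time slots accumulating at 0 *)

Section Glue.
Variables (R : realType) (V : normedModType R) (I : Type) (e : I -> V).
Variables (W : set V) (tau : V -> R) (c : I -> R) (a b : nat -> R).
Hypotheses (oW : open W) (ctau : continuous tau).
Hypothesis tau_line : forall j (h : R) y, tau (h *: e j + y) = h * c j + tau y.
Hypotheses (a_gt0 : forall k, 0 < a k) (ab : forall k, a k <= b k)
  (ba : forall k l, (k < l)%N -> b l < a k)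
  (b_cvg0 : forall t, 0 < t -> exists k, b k < t).

Let slot t k := a k <= t <= b k.

Let slot_inj t k l : slot t k -> slot t l -> k = l.
Proof.
move=> /andP[ak bk] /andP[al bl]; case: (ltngtP k l) => // kl.
- by have := lt_le_trans (ba kl) ak; rewrite ltNge bl.
- by have := lt_le_trans (ba kl) al; rewrite ltNge bk.
Qed.

(** Slots accumulate only at 0. For t > 0 take the least k with b (k+1) < t: later slots lie below b
    (k+1), and earlier ones above t since t <= b k when k > 0. The shift by one leaves slot k free
    to contain t. *)
Let slot_near t : t != 0 ->
  exists k, \forall u \near t, forall l, l != k -> ~~ slot u l.
Proof.
have [t0 _|t0 _|-> /eqP//] := ltrgt0P t; last first.
  exists 0%N; near=> u => l _; rewrite /slot negb_and -ltNge.
  by rewrite (lt_trans _ (a_gt0 l))//; near: u; exact: lt_nbhsl.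
have exk : exists k, b k.+1 < t.
  have [[|k] bk] := b_cvg0 t0; last by exists k.
  exists 0%N; apply: lt_trans bk.
  exact: (lt_le_trans (ba (ltnSn 0))).
exists (ex_minn exk); case: ex_minnP => k bk kmin.
have nb : \forall u \near t, b k.+1 < u by exact: lt_nbhsr.
have na : \forall u \near t, forall l, (l < k)%N -> u < a l.
  case: k kmin {bk nb} => [|k] kmin; first by near=> u.
  have tk : t < a k.
    apply: le_lt_trans (ba (ltnSn k)); rewrite leNgt; apply/negP => /kmin.
    by rewrite ltnn.
  have : \forall u \near t, u < a k by exact: lt_nbhsl.
  apply: filterS => u uk l; rewrite ltnS leq_eqVlt => /orP[/eqP->//|lk].
  by apply: (lt_trans uk); exact: le_lt_trans (ab k) (ba lk).
near=> u => l lk; rewrite /slot negb_and -!ltNge.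
have [kl|{}lk|/eqP] := ltngtP k l; last by rewrite eq_sym (negPf lk).
  apply/orP; right; have bu : b k.+1 < u by near: u.
  move: kl; rewrite leq_eqVlt => /orP[/eqP<-//|kl].
  by apply: lt_trans bu; exact: lt_le_trans (ba kl) (ab _).
have H : forall l, (l < k)%N -> u < a l by near: u.
by apply/orP; left; exact: H.
Unshelve. all: by end_near. Qed.

(** The default 0 outside all slots is harmless, because there every member of a [glueable] family
    vanishes. *)
Definition slot_index t := xget 0%N [set k | a k <= t <= b k].

Definition glue (F : nat -> V -> R) y := F (slot_index (tau y)) y.

(** Shaped so as to be stable under differentiation: the last clause speaks of every iterated
    derivative. The square makes both the value and the first derivatives of the glued function
    vanish at tau = 0, and bounding large k only is enough, as no other slot comes near tau = 0. *)
Definition glueable (F : nat -> V -> R) :=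
  [/\ forall k, smooth e W (F k),
      forall k y, W y -> ~~ (a k <= tau y <= b k) -> F k y = 0 &
      forall s, exists k0, forall k y, (k0 <= k)%N -> W y ->
        `|dpart e s (F k) y| <= tau y ^+ 2].

Let glueE F k y : glueable F -> W y ->
  (forall l, l != k -> ~~ slot (tau y) l) -> glue F y = F k y.
Proof.
move=> [_ F0 _] Wy Hk; rewrite /glue; have [->//|nk] := eqVneq (slot_index (tau y)) k.
rewrite (F0 _ _ Wy (Hk _ nk)) (F0 _ _ Wy)//.
apply/negP => sk; move: nk; rewrite /slot_index.
by case: xgetP => [l -> /= sl|/(_ k)//]; rewrite (slot_inj sl sk) eqxx.
Qed.

(** The index k depends on y only, so that a family and its family of derivatives can be read in the
    same slot. *)
Let glue_near y : W y -> tau y != 0 -> exists k, forall F, glueable F ->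
  (\forall z \near y, F k z = glue F z) /\ F k y = glue F y.
Proof.
move=> Wy /slot_near[k Hk]; exists k => F gF.
have H : \forall z \near y, F k z = glue F z.
  have ck : \forall z \near y, forall l, l != k -> ~~ slot (tau z) l.
    exact: ctau Hk.
  near=> z; apply/esym/glueE => //; last by near: z.
  by near: z; exact: open_nbhs_nbhs.
by split=> //; exact: nbhs_singleton H.
Unshelve. all: by end_near. Qed.

Let glue0 F y : glueable F -> W y -> tau y = 0 -> glue F y = 0.
Proof.
move=> [_ F0 _] Wy t0; rewrite /glue F0// t0 negb_and -ltNge.
by rewrite a_gt0.
Qed.

(** Below a k0 no slot of index less than k0 is met: either the index is at least k0 and the clause
    on derivatives applies, or the chosen member vanishes. *)
Let glue_bound F y : glueable F -> W y -> tau y = 0 ->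
  \forall z \near y, `|glue F z| <= tau z ^+ 2.
Proof.
move=> [_ F0 Fb] Wy t0; have [k0 Hk0] := Fb [::].
have ta : \forall z \near y, tau z < a k0.
  have := ctau (x := y); rewrite /continuous_at t0 => /cvgr_lt; apply.
  exact: a_gt0.
near=> z; have Wz : W z by near: z; exact: open_nbhs_nbhs.
have za : tau z < a k0 by near: z.
rewrite /glue; set k := slot_index _.
have [k0k|kk0] := leqP k0 k; first exact: Hk0.
rewrite F0 ?normr0 ?sqr_ge0// negb_and -!ltNge; apply/orP; left.
exact: (lt_le_trans za (ltW (le_lt_trans (ab k0) (ba kk0)))).
Unshelve. all: by end_near. Qed.

Lemma glueable_derive F j : glueable F -> glueable (fun k => 'D_(e j) (F k)).
Proof.
move=> [SF F0 Fb]; split=> [k|k y Wy nk|s].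
- exact: smooth_derive.
- have nE : \forall z \near y, F k z = cst 0 z.
    have nk' : \forall z \near y, ~~ slot (tau z) k.
      move: nk; rewrite negb_and -!ltNge => /orP[ta|tb].
        near=> z; rewrite /slot negb_and -!ltNge; apply/orP; left; near: z.
        exact: (cvgr_lt _ (ctau (x := y))).
      near=> z; rewrite /slot negb_and -!ltNge; apply/orP; right; near: z.
      exact: (cvgr_gt _ (ctau (x := y))).
    near=> z; apply: F0; last by near: z.
    by near: z; exact: open_nbhs_nbhs.
  by rewrite (near_eq_derive _ nE) derive_cst.
- have [k0 Hk0] := Fb (rcons s j); exists k0 => k y k0k Wy.
  by rewrite -dpart_rcons; exact: Hk0.
Unshelve. all: by end_near. Qed.

Lemma continuous_glue F y : glueable F -> W y -> {for y, continuous (glue F)}.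
Proof.
move=> gF Wy; have [t0|t0] := eqVneq (tau y) 0; last first.
  have [k /(_ F gF)[nE E]] := glue_near Wy t0.
  rewrite /prop_for /continuous_at -E; apply: cvg_trans (near_eq_cvg nE) _.
  by have [SF _ _] := gF; exact: smooth_continuous (SF k) Wy.
rewrite /prop_for /continuous_at glue0//.
have ct : tau z ^+ 2 @[z --> y] --> (0 : R).
  have -> : (0 : R) = tau y * tau y by rewrite t0 mulr0.
  by under eq_fun do rewrite expr2; apply: cvgM; exact: ctau.
apply/cvgrPdist_lt => eps eps0; near=> z.
rewrite sub0r normrN; apply: (@le_lt_trans _ _ (tau z ^+ 2)).
  by near: z; exact: glue_bound.
by near: z; exact: (cvgr_lt _ ct).
Unshelve. all: by end_near. Qed.

(** Away from tau = 0 the glued function is locally one F k. At tau y = 0, a move by h along e j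
    makes tau equal to h c j, so the difference quotient is at most |h| (c j)^2. *)
Lemma is_derive_glue F j y : glueable F -> W y ->
  is_derive y (e j) (glue F) (glue (fun k => 'D_(e j) (F k)) y).
Proof.
move=> gF Wy; have gF' := glueable_derive j gF.
have [t0|t0] := eqVneq (tau y) 0; last first.
  have [k Hk] := glue_near Wy t0; have [nE _] := Hk _ gF.
  apply: near_eq_is_derive nE _.
  have [SF _ _] := gF; have dF := smooth_derivable (j := j) (SF k) Wy.
  apply: DeriveDef => //.
  by have [_ <-] := Hk _ gF'.
rewrite (glue0 gF' Wy t0).
have H : h^-1 *: (glue F (h *: e j + y) - glue F y) @[h --> (0 : R)^'] --> (0 : R).
  rewrite (glue0 gF Wy t0); apply/cvgrPdist_le => eps eps0.
  have cl : h *: e j + y @[h --> (0 : R)^'] --> y.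
    have c0 : h *: e j + y @[h --> (0 : R)] --> y.
      rewrite -[X in _ --> X]add0r -[X in _ --> X + _](scale0r (e j)).
      by apply: cvgD; [apply: cvgZr_tmp; exact: cvg_id|exact: cvg_cst].
    by apply: cvg_trans c0; apply: cvg_app; exact: cvg_within.
  have B : \forall h \near (0 : R)^',
      `|glue F (h *: e j + y)| <= tau (h *: e j + y) ^+ 2.
    exact: cl _ (glue_bound gF Wy t0).
  near=> h; have h0 : h != 0 by near: h; exact: nbhs_dnbhs_neq.
  rewrite sub0r normrN subr0 normrM normfV ler_pdivrMl ?normr_gt0//.
  apply: (@le_trans _ _ (tau (h *: e j + y) ^+ 2)); first by near: h.
  rewrite tau_line t0 addr0 -[leLHS]ger0_norm ?sqr_ge0// normrX normrM expr2.
  rewrite -mulrA ler_wpM2l// mulrCA.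
  apply: (@le_trans _ _ (`|h| * (`|c j| * `|c j| + 1))).
    by rewrite ler_wpM2l// lerDl.
  have p : 0 < `|c j| * `|c j| + 1 by rewrite ltr_wpDl// mulr_ge0.
  rewrite -ler_pdivlMr// ltW//; near: h; apply: dnbhs0_lt; exact: divr_gt0.
apply: DeriveDef; first by apply/cvg_ex; exists 0.
exact/cvg_lim.
Unshelve. all: by end_near. Qed.

Lemma smooth_glue F : glueable F -> smooth e W (glue F).
Proof.
move=> gF r; elim: r F gF => [|r IH] F gF.
  by split=> // y Wy; exact: continuous_glue.
split=> [y Wy|j]; first exact: continuous_glue.
split=> [y Wy|]; first by case: (is_derive_glue j gF Wy).
apply: eq_ckon oW _ (IH _ (glueable_derive j gF)) => y Wy.
by rewrite (@derive_val _ _ _ _ _ _ _ (is_derive_glue j gF Wy)).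
Qed.

End Glue.

(** * The concrete slots, their bumps and the tolerances *)

Section TimeSlots.
Variable R : realType.
Implicit Types (t : R) (k n : nat).

(** Ratio 4 against a lower end at half the upper one: the next slot ends at a quarter of
    [slot_hi k], strictly below [slot_lo k]. *)
Definition slot_hi k : R := 4^-1 ^+ k.
Definition slot_lo k : R := slot_hi k / 2.
Definition slot_mid k : R := slot_hi k * (3 / 4).

(** The slot has half-length [slot_hi k / 4], so the factor rescales it to [-1, 1]; the square is
    smooth, is 0 at the midpoint and reaches 1 at both ends. *)
Definition slot_bump k t : R := cutoff (((t - slot_mid k) * (4 / slot_hi k)) ^+ 2).

Lemma slot_hi_gt0 k : 0 < slot_hi k.
Proof. by rewrite exprn_gt0// invr_gt0. Qed.

Lemma slot_lo_gt0 k : 0 < slot_lo k.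
Proof. by rewrite divr_gt0// slot_hi_gt0. Qed.

Lemma slot_lo_le_hi k : slot_lo k <= slot_hi k.
Proof. by have := slot_hi_gt0 k; rewrite /slot_lo; lra. Qed.

Lemma slot_sep k l : (k < l)%N -> slot_hi l < slot_lo k.
Proof.
move=> kl; apply: (@le_lt_trans _ _ (slot_hi k.+1)).
  by rewrite /slot_hi; apply: ler_wiXn2l => //; rewrite ?invr_ge0// invf_le1 ?ler1n.
by have := slot_hi_gt0 k; rewrite /slot_lo /slot_hi exprS; lra.
Qed.

Lemma slot_hi_cvg0 t : 0 < t -> exists k, slot_hi k < t.
Proof.
move=> t0; have c : slot_hi k @[k --> \oo] --> (0 : R).
  by apply: cvg_expr; rewrite ger0_norm ?invr_ge0// invf_lt1 ?ltr1n.
have [k _ Hk] := cvgr_lt _ c _ t0.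
by exists k; apply: Hk => /=.
Qed.

Lemma slot_mid_cvg0 : slot_mid k @[k --> \oo] --> (0 : R).
Proof.
rewrite -[X in _ --> X](mul0r (3 / 4)); apply: cvgMr_tmp.
by apply: cvg_expr; rewrite ger0_norm ?invr_ge0// invf_lt1 ?ltr1n.
Qed.

Lemma slot_mid_in k : slot_lo k <= slot_mid k <= slot_hi k.
Proof. by have := slot_hi_gt0 k; rewrite /slot_lo /slot_mid; lra. Qed.

Lemma slot_bump_mid k : slot_bump k (slot_mid k) = 1.
Proof. by rewrite /slot_bump subrr mul0r expr0n cutoff_le0. Qed.

Lemma slot_bump_out k t : ~~ (slot_lo k <= t <= slot_hi k) -> slot_bump k t = 0.
Proof.
move=> nt; apply: cutoff_ge1; have h0 := slot_hi_gt0 k.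
have H : 1 <= `|(t - slot_mid k) * (4 / slot_hi k)|.
  rewrite normrM (ger0_norm (_ : 0 <= 4 / slot_hi k)); last first.
    by rewrite divr_ge0// ltW.
  rewrite mulrA ler_pdivlMr// mul1r.
  move: nt; rewrite negb_and -!ltNge /slot_lo /slot_mid.
  move: (slot_hi k) h0 => h h0 /orP[] th.
    by rewrite ler0_norm; lra.
  by rewrite ger0_norm; lra.
rewrite -[leRHS]real_normK ?num_real// -[leLHS](expr1n _ 2).
by rewrite lerXn2r ?nnegrE ?ler01 ?normr_ge0.
Qed.

Lemma smooth_slot_bump k : smooth (@dir1 R) setT (slot_bump k).
Proof.
move=> r; apply: (ckon_comp1 (g := @cutoff R)
  (u := fun t => ((t - slot_mid k) * (4 / slot_hi k)) ^+ 2)) openT _ _.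
  exact: smooth_cutoff.
have H : ckon (@dir1 R) r setT (fun t => (t - slot_mid k) * (4 / slot_hi k)).
  apply: ckonM openT _ _; last exact: ckon_cst.
  apply: ckonB openT _ _; last exact: ckon_cst.
  apply: ckon_affine => [t|j]; first exact: cvg_id.
  by exists 1 => t; exact: is_derive_id.
by have := ckonM openT H H; apply: eq_ckon openT _ => t _; rewrite expr2.
Qed.

Lemma dpart_cst0 (V : normedModType R) (I : Type) (e : I -> V) s :
  dpart e s (cst 0 : V -> R) = cst 0.
Proof.
by elim: s => //= j s ->; apply/funext => x; rewrite derive_cst.
Qed.

Lemma dpart_slot_bump_out k n t : ~~ (slot_lo k <= t <= slot_hi k) ->
  dpart (@dir1 R) (nseq n tt) (slot_bump k) t = 0.
Proof.
move=> nt.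
have oW : open ([set u | u < slot_lo k] `|` [set u | slot_hi k < u]).
  by apply: openU; [exact: open_lt|exact: open_gt].
rewrite (eq_dpart (h := cst 0) _ _ oW); first by rewrite dpart_cst0.
  move=> u Wu; apply: slot_bump_out; rewrite negb_and -!ltNge.
  by apply/orP; case: Wu => /= ?; [left|right].
by move: nt; rewrite negb_and -!ltNge => /orP[]; [left|right].
Qed.

Lemma slot_bump_bound k n : exists2 B, 0 <= B &
  forall t, `|dpart (@dir1 R) (nseq n tt) (slot_bump k) t| <= B.
Proof.
set f := dpart _ _ _.
have cf : continuous (fun t => `|f t|).
  move=> t; apply: (@continuous_comp _ _ _ f Num.norm).
    exact: smooth_continuous (smooth_dpart _ (smooth_slot_bump k)) Logic.I.
  exact: norm_continuous.
have [c _ Hc] := EVT_max (slot_lo_le_hi k) (continuous_subspaceT cf).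
exists `|f c| => // t; have [ts|nts] := boolP (slot_lo k <= t <= slot_hi k).
  by apply: Hc; rewrite in_itv.
by rewrite /f dpart_slot_bump_out ?normr0.
Qed.

(* The bound slot_lo k ^+ 2 <= t ^+ 2 on the k-th slot is what makes all the
   derivatives of the glued function exist and vanish at t = 0. *)
Lemma slot_tolerance : exists2 eps : nat -> R, forall k, 0 < eps k &
  forall k n t, (n <= k)%N ->
    `|dpart (@dir1 R) (nseq n tt) (slot_bump k) t| * eps k <= slot_lo k ^+ 2.
Proof.
have H k : exists E : R, 0 < E /\ forall n t, (n <= k)%N ->
    `|dpart (@dir1 R) (nseq n tt) (slot_bump k) t| * E <= slot_lo k ^+ 2.
  have HB n : exists B, 0 <= B /\
      forall t, `|dpart (@dir1 R) (nseq n tt) (slot_bump k) t| <= B.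
    by have [B B0 HB] := slot_bump_bound k n; exists B.
  have [B HB'] := choice HB.
  (* One tolerance must serve all orders n <= k, so their bounds are added up. *)
  pose S := \sum_(n < k.+1) B n.
  have S0 : 0 <= S by apply: sumr_ge0 => n _; have [] := HB' n.
  have S1 : 0 < S + 1 by rewrite ltr_wpDl.
  exists (slot_lo k ^+ 2 / (S + 1)); split.
    by rewrite divr_gt0// exprn_gt0// slot_lo_gt0.
  move=> n t nk; rewrite mulrCA -[leRHS]mulr1 ler_wpM2l ?sqr_ge0//.
  rewrite ler_pdivrMr// mul1r; have [_ /(_ t)/le_trans -> //] := HB' n.
  have nk' : (n < k.+1)%N by [].
  rewrite /S (bigD1 (Ordinal nk'))//= -addrA lerDl addr_ge0//.
  by apply: sumr_ge0 => l _; have [] := HB' l.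
have [eps Heps] := choice H.
by exists eps => [k|k n t nk]; have [? Hk] := Heps k => //; exact: Hk.
Qed.

End TimeSlots.

(** * Products of a function of time and a function of space *)

Section TimeSpace.
Variables (R : realType) (m : nat).
Implicit Types (y : 'rV[R]_(1 + m)) (x : 'rV[R]_m).

Definition time y : R := lsubmx y 0 0.

Lemma time_line (j : 'I_(1 + m)) (h : R) y :
  time (h *: dirs R j + y) = h * time (dirs R j) + time y.
Proof. by rewrite /time linearD linearZ !mxE. Qed.

Lemma time_continuous : continuous time.
Proof.
by move=> y; rewrite /time /continuous_at; under eq_fun do rewrite mxE;
  rewrite mxE; exact: coord_continuous.
Qed.

Lemma ckon_coord n (i : 'I_n) r (W : set 'rV[R]_n) :
  ckon (@dirs R n) r W (fun v : 'rV[R]_n => v 0 i).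
Proof.
apply: ckon_affine => [v|j]; first exact: coord_continuous.
exists ((dirs R j) 0 i) => v.
have -> : (dirs R j) 0 i = 'D_(dirs R j) (fun v : 'rV[R]_n => v) v 0 i.
  by rewrite derive_id.
have d : derivable (fun v : 'rV[R]_n => v) v (dirs R j) by exact: derivable_id.
apply: DeriveDef; first exact: (derivable_mxP _ _ _).1 d 0 i.
by rewrite derive_mx// mxE.
Qed.

Lemma ckon_time r W : ckon (@dirs R (1 + m)) r W time.
Proof.
have -> : time = (fun y => y 0 (lshift m 0)) by apply/funext => y; rewrite /time mxE.
exact: ckon_coord.
Qed.

Lemma time_dirsl (i : 'I_1) : time (dirs R (lshift m i)) = 1.
Proof. by rewrite /time !mxE !ord1 !eqxx. Qed.

Lemma time_dirsr (i : 'I_m) : time (dirs R (rshift 1 i)) = 0.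
Proof. by rewrite /time !mxE eqxx eq_lrshift. Qed.

Lemma rsubmx_dirsl (i : 'I_1) : @rsubmx R 1 1 m (dirs R (lshift m i)) = 0.
Proof. by apply/rowP => k; rewrite !mxE eqxx eq_rlshift. Qed.

Lemma rsubmx_dirsr (i : 'I_m) : @rsubmx R 1 1 m (dirs R (rshift 1 i)) = dirs R i.
Proof. by apply/rowP => k; rewrite !mxE eqxx eq_rshift. Qed.

Lemma rsubmx_continuous : continuous (@rsubmx R 1 1 m).
Proof.
move=> y; apply: continuous_rV => i; rewrite /prop_for /continuous_at.
by under eq_fun do rewrite mxE; rewrite mxE; exact: coord_continuous.
Qed.

Lemma ckon_rsubmx r (W : set 'rV[R]_m) (g : 'rV[R]_m -> R) : open W ->
  ckon (@dirs R m) r W g ->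
  ckon (@dirs R (1 + m)) r (@rsubmx R 1 1 m @^-1` W) (fun y => g (rsubmx y)).
Proof.
move=> oW Cg; apply: (ckon_comp (W' := W) (g := g) (G := @rsubmx R 1 1 m)) => //.
  by apply: open_comp => // y _; exact: rsubmx_continuous.
move=> i; have -> : (fun y : 'rV[R]_(1 + m) => rsubmx y 0 i) = (fun y => y 0 (rshift 1 i)).
  by apply/funext => y; rewrite mxE.
exact: ckon_coord.
Qed.

Lemma derive_shift1 (g : R -> R) t : 'D_(1 : R) (fun h : R => g (h + t)) 0 = 'D_(1 : R) g t.
Proof.
rewrite (derive_line g t (1 : R)).
have -> : (fun h : R => g (h + t)) = (fun h : R => g (h *: 1 + t)).
  by apply/funext => h; rewrite [h *: 1]mulr1.
by [].
Qed.

(** The splitting of s into n time derivatives and the space derivatives s' is chosen before f and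
    g, so that the same n and s' serve all slots at once. *)
Lemma dpart_product s : exists n s', [/\ (n <= size s)%N, (size s' <= size s)%N &
  forall (W : set 'rV[R]_m) (f : R -> R) (g : 'rV[R]_m -> R) y,
    open W -> smooth (@dir1 R) setT f -> smooth (@dirs R m) W g -> W (rsubmx y) ->
    dpart (@dirs R (1 + m)) s (fun y => f (time y) * g (rsubmx y)) y =
    dpart (@dir1 R) (nseq n tt) f (time y) * dpart (@dirs R m) s' g (rsubmx y)].
Proof.
elim: s => [|j s [n [s' [ns ss' IH]]]]; first by exists 0%N, [::].
have E W f g y : open W -> smooth (@dir1 R) setT f -> smooth (@dirs R m) W g ->
    W (rsubmx y) -> dpart (@dirs R (1 + m)) (j :: s) (fun y => f (time y) * g (rsubmx y)) y =
    'D_(1 : R) (fun h : R => dpart (@dir1 R) (nseq n tt) f (h * time (dirs R j) + time y) *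
      dpart (@dirs R m) s' g (h *: rsubmx (dirs R j) + rsubmx y)) 0.
  move=> oW Cf Cg Wy /=.
  have oW' : open (@rsubmx R 1 1 m @^-1` W).
    by apply: open_comp => // z _; exact: rsubmx_continuous.
  have nE : \forall z \near y,
      dpart (@dirs R (1 + m)) s (fun y => f (time y) * g (rsubmx y)) z =
      dpart (@dir1 R) (nseq n tt) f (time z) * dpart (@dirs R m) s' g (rsubmx z).
    near=> z; apply: (IH W) => //; near: z; exact: open_nbhs_nbhs.
  rewrite (near_eq_derive _ nE) derive_line.
  set F := (X in derive X _ _ = _); set G := (X in _ = derive X _ _).
  have -> : F = G by apply/funext => h; rewrite /F /G time_line linearD linearZ.
  by [].
case: (splitP j) => [i ij|i ij].
- have {ij} ij : j = lshift m i by apply: val_inj.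
  exists n.+1, s'; split=> //; first exact: leqW.
  move=> W f g y oW Cf Cg Wy; rewrite (E W f g y oW Cf Cg Wy) ij time_dirsl rsubmx_dirsl /=.
  under eq_fun do rewrite mulr1 scaler0 add0r mulrC.
  rewrite (derive_shift1 (fun t => dpart (@dirs R m) s' g (rsubmx y) *
     dpart (@dir1 R) (nseq n tt) f t)).
  rewrite deriveMl; first by rewrite mulrC.
  by apply: (smooth_derivable (e := @dir1 R) (j := tt)) (smooth_dpart _ Cf) Logic.I.
- have {ij} ij : j = rshift 1 i by apply: val_inj.
  exists n, (i :: s'); split=> //; first exact: leqW.
  move=> W f g y oW Cf Cg Wy; rewrite (E W f g y oW Cf Cg Wy) ij time_dirsr rsubmx_dirsr /=.
  under eq_fun do rewrite mulr0 add0r.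
  rewrite -(derive_line (fun x => dpart (@dir1 R) (nseq n tt) f (time y) *
     dpart (@dirs R m) s' g x)).
  rewrite deriveMl//.
  exact: smooth_derivable (smooth_dpart _ Cg) Wy.
Unshelve. all: by end_near. Qed.

Definition slot_of (t : R) : nat := slot_index (@slot_lo R) (@slot_hi R) t.

Lemma slot_of_mid k : slot_of (slot_mid R k) = k.
Proof.
rewrite /slot_of /slot_index; case: xgetP => [l _ /andP[al bl]|/(_ k)/=]; last first.
  by rewrite slot_mid_in.
have /andP[ak bk] := slot_mid_in R k.
case: (ltngtP k l) => // kl.
- by have := lt_le_trans (slot_sep R kl) ak; rewrite ltNge bl.
- by have := lt_le_trans (slot_sep R kl) al; rewrite ltNge bk.
Qed.

Definition slot_weight (t : R) : R := slot_bump (slot_of t) t.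

(** E k will be the difference of g_k and f in charts. For a fixed list s the gluing condition is
    only checked for k >= size s, which is where the bound on E k is available; on the k-th slot the
    product is at most [slot_lo R k ^+ 2], hence at most the square of the time. *)
Lemma smooth_slots (eps : nat -> R) (W : set 'rV[R]_m) (E : nat -> 'rV[R]_m -> R) :
  (forall k, 0 < eps k) ->
  (forall k n t, (n <= k)%N ->
    `|dpart (@dir1 R) (nseq n tt) (slot_bump k) t| * eps k <= slot_lo R k ^+ 2) ->
  open W -> (forall k, smooth (@dirs R m) W (E k)) ->
  (forall k s x, (size s <= k)%N -> W x ->
     `|dpart (@dirs R m) s (E k) x| <= eps k) ->
  smooth (@dirs R (1 + m)) (@rsubmx R 1 1 m @^-1` W)
    (fun y => slot_weight (time y) * E (slot_of (time y)) (rsubmx y)).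
Proof.
move=> eps0 Heps oW SE HE.
have oW' : open (@rsubmx R 1 1 m @^-1` W).
  by apply: open_comp => // z _; exact: rsubmx_continuous.
apply: (smooth_glue oW' time_continuous time_line (@slot_lo_gt0 R)
  (@slot_lo_le_hi R) (@slot_sep R) (@slot_hi_cvg0 R)
  (F := fun k y => slot_bump k (time y) * E k (rsubmx y))).
split=> [k r|k y _ ny|s].
- apply: ckonM => //; last by apply: ckon_rsubmx => //; exact: SE.
  apply: (ckon_comp1 (g := @slot_bump R k) (u := time)) => //.
    exact: smooth_slot_bump.
  exact: ckon_time.
- by rewrite slot_bump_out// mul0r.
- have [n [s' [ns ss' Hs]]] := dpart_product s.
  exists (size s) => k y sk Wy; rewrite (Hs W)//; last exact: smooth_slot_bump.
  have [ty|nty] := boolP (slot_lo R k <= time y <= slot_hi R k); last first.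
    by rewrite dpart_slot_bump_out// mul0r normr0 sqr_ge0.
  rewrite normrM; apply: (@le_trans _ _ (slot_lo R k ^+ 2)).
    apply: le_trans (Heps k n (time y) (leq_trans ns sk)).
    apply: ler_wpM2l => //; apply: HE => //; exact: leq_trans ss' sk.
  have /andP[lt _] := ty; have /ltW l0 := slot_lo_gt0 R k.
  by rewrite lerXn2r// nnegrE (le_trans l0).
Qed.

End TimeSpace.

(** * Smooth maps in charts *)

Lemma continuous_at_comp (X Y Z : topologicalType) (f : X -> Y) (g : Y -> Z) x :
  {for x, continuous f} -> {for f x, continuous g} ->
  {for x, continuous (g \o f)}.
Proof. exact: continuous_comp. Qed.

Lemma open_preimage_in (X Y : topologicalType) (f : X -> Y) (D : set X) (O : set Y) :
  open D -> (forall x, D x -> {for x, continuous f}) -> open O ->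
  open (D `&` f @^-1` O).
Proof.
move=> oD cf oO; rewrite openE => x [Dx Ofx]; apply: filterI.
  exact: open_nbhs_nbhs.
by apply: (cf x Dx); exact: open_nbhs_nbhs.
Qed.

Lemma continuous_at_near (X Y : topologicalType) (f g : X -> Y) (D : set X) x :
  open D -> D x -> (forall y, D y -> f y = g y) ->
  {for x, continuous f} -> {for x, continuous g}.
Proof.
move=> oD Dx fg cf; rewrite /prop_for /continuous_at -(fg x Dx).
apply: cvg_trans cf; apply: near_eq_cvg; near=> y; apply: fg; near: y.
exact: open_nbhs_nbhs.
Unshelve. all: by end_near. Qed.

Section SmoothOnComp.
Variables (R : realType).

Lemma eq_smooth_on m n (W : set 'rV[R]_m) (g h : 'rV[R]_m -> 'rV[R]_n) :
  open W -> (forall x, W x -> g x = h x) -> smooth_on W g -> smooth_on W h.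
Proof.
move=> oW gh /smooth_onP Sg; apply/smooth_onP => // i r.
by apply: eq_ckon oW _ (Sg oW i r) => x Wx; rewrite gh.
Qed.

Lemma smooth_onW m n (W W' : set 'rV[R]_m) (g : 'rV[R]_m -> 'rV[R]_n) :
  W' `<=` W -> smooth_on W g -> smooth_on W' g.
Proof. by move=> sW Sg s x /sW; exact: Sg. Qed.

Lemma smooth_on_comp m n p (W : set 'rV[R]_m) (W' : set 'rV[R]_n)
    (g : 'rV[R]_m -> 'rV[R]_n) (h : 'rV[R]_n -> 'rV[R]_p) :
  open W -> open W' -> (forall x, W x -> W' (g x)) ->
  smooth_on W g -> smooth_on W' h -> smooth_on W (h \o g).
Proof.
move=> oW oW' gW /(smooth_onP _ oW) Sg /(smooth_onP _ oW') Sh.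
apply/(smooth_onP _ oW) => i r.
apply: (ckon_comp (W' := W') (g := fun v => h v 0 i) (G := g)) => //.
  exact: Sh.
by move=> j; exact: Sg.
Qed.

Lemma smooth_on_continuous m n (W : set 'rV[R]_m) (g : 'rV[R]_m -> 'rV[R]_n) x :
  smooth_on W g -> W x -> {for x, continuous g}.
Proof. by move=> Sg Wx; have [] := Sg [::] x Wx. Qed.

End SmoothOnComp.

Section Charts.
Variables (R : realType) (m : nat) (T : topologicalType).
Implicit Types (c : chart R m T).

Lemma chart_crange c x : cdom c x -> crange c (cfun c x).
Proof. by move=> cx; exists x. Qed.

Lemma chart_imageE c (O : set T) : is_chart c -> O `<=` cdom c ->
  cfun c @` O = crange c `&` cinv c @^-1` O.
Proof.
move=> [_ _ cK _ _] Oc; apply/seteqP; split=> [y [x Ox <-]|y [[x cx <-]]] /=.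
  by split; [exists x => //; exact: Oc|rewrite /= cK//; exact: Oc].
by rewrite cK// => Ox; exists x.
Qed.

Lemma open_chart_image c (O : set T) : is_chart c -> open O -> O `<=` cdom c ->
  open (cfun c @` O).
Proof.
move=> ic oO Oc; rewrite chart_imageE//; case: ic => _ orc _ _ ci.
exact: open_preimage_in.
Qed.

Lemma chart_cinvK c y : is_chart c -> crange c y -> cfun c (cinv c y) = y.
Proof. by move=> [_ _ cK _ _] [x cx <-]; rewrite cK. Qed.

Lemma chart_cinv_dom c y : is_chart c -> crange c y -> cdom c (cinv c y).
Proof. by move=> [_ _ cK _ _] [x cx <-]; rewrite cK. Qed.

(** Isolates what is used of an atlas, so that the product atlas on R x M can be handled without
    making a [manifold] of it. *)
Definition compatible (A : set (chart R m T)) :=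
  (forall c, A c -> is_chart c) /\
  (forall c d, A c -> A d -> transition_smooth c d).

End Charts.

Lemma compatible_atlas (R : realType) m (M : manifold R m) :
  compatible (atlas M).
Proof. by split; [exact: atlas_chart|exact: atlas_smooth]. Qed.

Section SmoothIn.
Variables (R : realType) (m n : nat) (T S : topologicalType).
Variables (A : set (chart R m T)) (B : set (chart R n S)).
Hypotheses (cA : compatible A) (cB : compatible B).
Implicit Types (f : T -> S) (O : set T).

Definition smooth_in f O :=
  (forall x, O x -> {for x, continuous f}) /\
  forall c d, A c -> B d ->
    smooth_on (cfun c @` (cdom c `&` O `&` f @^-1` cdom d))
              (cfun d \o f \o cinv c).

(** One pair of charts suffices: in any other pair, f is its expression in (c0, d0) composed with a
    transition map on either side. Continuity of f is read off from the same expression. *)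
Lemma smooth_in_chart f O c0 d0 : A c0 -> B d0 -> open O -> O `<=` cdom c0 ->
  (forall x, O x -> cdom d0 (f x)) ->
  smooth_on (cfun c0 @` O) (cfun d0 \o f \o cinv c0) -> smooth_in f O.
Proof.
move=> Ac Bd oO Oc Od Sf.
have [ioc orc cK cc ci] := cA.1 _ Ac; have [iod ord dK dc di] := cB.1 _ Bd.
have cf x : O x -> {for x, continuous f}.
  move=> Ox; apply: (@continuous_at_near _ _
    (cinv d0 \o (cfun d0 \o f \o cinv c0) \o cfun c0) _ O) => //.
    by move=> y Oy /=; rewrite cK; [rewrite dK//; exact: Od|exact: Oc].
  have cx := Oc _ Ox.
  apply: continuous_at_comp; first exact: cc.
  apply: continuous_at_comp; first by apply: smooth_on_continuous Sf _; exists x.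
  by rewrite /= cK//; apply: di; apply: chart_crange; exact: Od.
split=> // c d Ac' Bd'.
have [oc' orc' cK' cc' ci'] := cA.1 _ Ac'; have [od' ord' dK' dc' di'] := cB.1 _ Bd'.
set D := cdom c `&` O `&` f @^-1` cdom d.
have oD : open D.
  apply: open_preimage_in => //; first exact: openI.
  by move=> x [_ Ox]; exact: cf.
have Dc : D `<=` cdom c by move=> x [[]].
have oW : open (cfun c @` D) by apply: open_chart_image => //; exact: cA.1.
have oV : open (cfun d0 @` (cdom d0 `&` cdom d)).
  apply: open_chart_image; [exact: cB.1|exact: openI|exact: subIsetl].
have S1 : smooth_on (cfun c @` D) (cfun c0 \o cinv c).
  apply: smooth_onW (cA.2 _ _ Ac' Ac); apply: image_subset => x [[cx Ox] _].
  by split=> //; exact: Oc.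
have oU : open (cfun c0 @` O) by apply: open_chart_image => //; exact: cA.1.
have S3 : smooth_on (cfun c @` D) ((cfun d0 \o f \o cinv c0) \o (cfun c0 \o cinv c)).
  apply: (smooth_on_comp oW oU) => // y [x [[cx Ox] _] <-] /=.
  by rewrite cK'//; exists x.
have S4 : smooth_on (cfun c @` D) ((cfun d \o cinv d0) \o
    ((cfun d0 \o f \o cinv c0) \o (cfun c0 \o cinv c))).
  apply: (smooth_on_comp oW oV) => //; last exact: cB.2.
  move=> y [x [[cx Ox] dx] <-] /=; rewrite cK'// cK//; last exact: Oc.
  by exists (f x) => //; split=> //; exact: Od.
apply: eq_smooth_on oW _ S4 => y [x [[cx Ox] dx] <-] /=.
by rewrite cK'// cK; [rewrite dK//; exact: Od|exact: Oc].
Qed.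

(** The comparison map f' may change with the point: the final curve agrees near different points
    with different stages of the construction. *)
Lemma smooth_wrt_local f :
  (forall x, exists O f', [/\ open O, O x, forall y, O y -> f' y = f y &
    smooth_in f' O]) -> smooth_wrt A B f.
Proof.
move=> H.
have cf x : {for x, continuous f}.
  have [ O [f' [oO Ox E [cf' _]]]] := H x.
  exact: (continuous_at_near oO Ox E (cf' _ Ox)).
split=> [c x _ _|c d Ac Bd]; first exact: cf.
have [oc _ cK _ _] := cA.1 _ Ac; have [odd0 _ _ _ _] := cB.1 _ Bd.
move=> s y [x [cx dx] <-].
have [ O [f' [oO Ox E [cf' Sf']]]] := H x.
have oW : open (cfun c @` (cdom c `&` O `&` f' @^-1` cdom d)).
  apply: open_chart_image; first exact: cA.1.
    apply: open_preimage_in => //; first exact: openI.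
    by move=> z [_ Oz]; exact: cf'.
  by move=> z [[]].
have Sf : smooth_on (cfun c @` (cdom c `&` O `&` f' @^-1` cdom d))
    (cfun d \o f \o cinv c).
  apply: eq_smooth_on oW _ (Sf' c d Ac Bd) => z [z' [[cz Oz] dz] <-] /=.
  by rewrite cK// E.
by apply: Sf; exists x => //; split=> //=; rewrite E.
Qed.

End SmoothIn.

(** * Charts on R x M and time slices *)

Section ProductCharts.
Variables (R : realType) (m : nat) (M : manifold R m).

Lemma row_mx_continuous (T : topologicalType) k l (f : T -> 'rV[R]_k)
    (g : T -> 'rV[R]_l) x : {for x, continuous f} -> {for x, continuous g} ->
  {for x, continuous (fun y => row_mx (f y) (g y))}.
Proof.
move=> cf cg; apply: continuous_rV => i.
case: (splitP i) => j ij.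
  have -> : i = lshift l j by apply: val_inj.
  have -> : (fun y => row_mx (f y) (g y) 0 (lshift l j)) = (fun y => f y 0 j).
    by apply/funext => y; rewrite row_mxEl.
  exact: continuous_entry.
have -> : i = rshift k j by apply: val_inj.
have -> : (fun y => row_mx (f y) (g y) 0 (rshift k j)) = (fun y => g y 0 j).
  by apply/funext => y; rewrite row_mxEr.
exact: continuous_entry.
Qed.

Lemma lsubmx_continuous : continuous (@lsubmx R 1 1 m).
Proof.
move=> y; apply: continuous_rV => i; rewrite /prop_for /continuous_at.
by under eq_fun do rewrite mxE; rewrite mxE; exact: coord_continuous.
Qed.

Lemma prod_crange (c : chart R m M) :
  crange (prod_chart (k := 1) setT c) = @rsubmx R 1 1 m @^-1` crange c.
Proof.
apply/seteqP; split=> [y [[u x] [_ cx] <-]|y [x cx E]] /=.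
  by rewrite row_mxKr; exists x.
by exists (lsubmx y, x) => //=; rewrite E hsubmxK.
Qed.

Lemma is_chart_prod (c : chart R m M) : is_chart c ->
  is_chart (prod_chart (k := 1) setT c).
Proof.
move=> ic; have [oc orc cK cc ci] := ic; split.
- have -> : cdom (prod_chart (k := 1) setT c) = snd @^-1` cdom c.
    by apply/seteqP; split=> [[u x] [_ cx]|[u x] cx].
  by apply: open_comp => // x _; exact: cvg_snd.
- by rewrite prod_crange; apply: open_comp => // y _; exact: rsubmx_continuous.
- by move=> [u x] [_ cx] /=; rewrite row_mxKl row_mxKr cK.
- move=> [u x] [_ cx].
  apply: (@row_mx_continuous _ _ _ fst (fun z => cfun c z.2)); first exact: cvg_fst.
  apply: (@continuous_at_comp _ _ _ snd (cfun c)); first exact: cvg_snd.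
  exact: cc.
- move=> y; rewrite prod_crange => cy.
  have cl : {for y, continuous (@lsubmx R 1 1 m)} by exact: lsubmx_continuous.
  have cr : {for y, continuous (fun y => cinv c (@rsubmx R 1 1 m y))}.
    apply: (@continuous_at_comp _ _ _ (@rsubmx R 1 1 m) (cinv c)).
      exact: rsubmx_continuous.
    exact: ci.
  exact: (cvg_pair cl cr).
Qed.

Lemma smooth_on_row_mx p k l (W : set 'rV[R]_p) (f : 'rV[R]_p -> 'rV[R]_k)
    (g : 'rV[R]_p -> 'rV[R]_l) : open W -> smooth_on W f -> smooth_on W g ->
  smooth_on W (fun y => row_mx (f y) (g y)).
Proof.
move=> oW /(smooth_onP _ oW) Sf /(smooth_onP _ oW) Sg; apply/(smooth_onP _ oW).
move=> i; case: (splitP i) => j ij.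
  have -> : i = lshift l j by apply: val_inj.
  have -> : (fun y => row_mx (f y) (g y) 0 (lshift l j)) = (fun y => f y 0 j).
    by apply/funext => y; rewrite row_mxEl.
  exact: Sf.
have -> : i = rshift k j by apply: val_inj.
have -> : (fun y => row_mx (f y) (g y) 0 (rshift k j)) = (fun y => g y 0 j).
  by apply/funext => y; rewrite row_mxEr.
exact: Sg.
Qed.

Lemma smooth_on_rsubmx (W : set 'rV[R]_(1 + m)) : open W -> smooth_on W (@rsubmx R 1 1 m).
Proof.
move=> oW; apply/(smooth_onP _ oW) => i r.
have -> : (fun y : 'rV[R]_(1 + m) => rsubmx y 0 i) = (fun y => y 0 (rshift 1 i)).
  by apply/funext => y; rewrite mxE.
exact: ckon_coord.
Qed.

Lemma smooth_on_lsubmx (W : set 'rV[R]_(1 + m)) : open W -> smooth_on W (@lsubmx R 1 1 m).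
Proof.
move=> oW; apply/(smooth_onP _ oW) => i r.
have -> : (fun y : 'rV[R]_(1 + m) => lsubmx y 0 i) = (fun y => y 0 (lshift m i)).
  by apply/funext => y; rewrite mxE.
exact: ckon_coord.
Qed.

Lemma compatible_prod : compatible (prod_atlas (k := 1) setT M).
Proof.
split=> [_ [c Mc <-]|_ _ [c Mc <-] [d Md <-]].
  by apply: is_chart_prod; exact: atlas_chart.
set c' := prod_chart _ c; set d' := prod_chart _ d.
have ic' : is_chart c' by apply: is_chart_prod; exact: atlas_chart.
have id' : is_chart d' by apply: is_chart_prod; exact: atlas_chart.
rewrite /transition_smooth; set W := cfun c' @` _.
have oW : open W.
  have [oc' _ _ _ _] := ic'; have [od' _ _ _ _] := id'.
  apply: open_chart_image; [exact: ic'|exact: openI oc' od'|exact: subIsetl].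
apply: smooth_on_row_mx => //=; first exact: smooth_on_lsubmx.
apply: (smooth_on_comp (W' := cfun c @` (cdom c `&` cdom d))
  (g := @rsubmx R 1 1 m) (h := cfun d \o cinv c)) => //.
- apply: open_chart_image; first exact: atlas_chart.
    by apply: openI; [case: (atlas_chart Mc)|case: (atlas_chart Md)].
  exact: subIsetl.
- move=> y [[u x] [[_ cx] [_ dx]] <-] /=; rewrite row_mxKr.
  by exists x.
- exact: smooth_on_rsubmx.
- exact: atlas_smooth.
Qed.

(** Needed to regard each time slice of the curve as an element of [Cinf M N]. In charts the slice
    is a composite with v |-> (u, v). *)
Lemma smooth_wrt_slice n (N : manifold R n) (z : 'rV[R]_1 * M -> N) u :
  smooth_wrt (prod_atlas setT M) (atlas N) z ->
  smooth_wrt (atlas M) (atlas N) (fun x => z (u, x)).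
Proof.
move=> [cz Sz].
have cz' x : {for x, continuous (fun x => z (u, x))}.
  have [c Mc cx] := atlas_cover x.
  apply: (@continuous_at_comp _ _ _ (fun x => (u, x)) z).
    have c1 : {for x, continuous (fun _ : M => u)} by exact: cvg_cst.
    have c2 : {for x, continuous (fun x : M => x)} by exact: cvg_id.
    exact: (cvg_pair c1 c2).
  by apply: (cz (prod_chart setT c)) => //; exists c.
split=> [c x _ _|c d Mc Nd]; first exact: cz'.
have [oc _ cK _ _] := atlas_chart Mc; have [odd0 _ _ _ _] := atlas_chart Nd.
set W := cfun c @` _.
have oW : open W.
  apply: open_chart_image; first exact: atlas_chart.
    by apply: open_preimage_in => // x _; exact: cz'.
  exact: subIsetl.
have Mc' : prod_atlas setT M (prod_chart (k := 1) setT c) by exists c.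
have oW' : open (cfun (prod_chart (k := 1) setT c) @`
    (cdom (prod_chart setT c) `&` z @^-1` cdom d)).
  apply: open_chart_image.
  - exact: compatible_prod.1.
  - apply: open_preimage_in => //; last by move=> x cx; exact: cz Mc' cx.
    by have [] := compatible_prod.1 _ Mc'.
  - exact: subIsetl.
have Sr : smooth_on W (fun v : 'rV[R]_m => row_mx u v).
  apply: smooth_on_row_mx => //; apply/(smooth_onP _ oW) => i r.
    exact: ckon_cst.
  exact: ckon_coord.
apply: eq_smooth_on oW _ (smooth_on_comp oW oW' _ Sr (Sz _ _ Mc' Nd)).
- by move=> y _ /=; rewrite row_mxKl row_mxKr.
- by move=> y [x [cx dx] <-]; exists (u, x).
Qed.

End ProductCharts.

(** * Covers adapted to a map *)

(** Number the basic open sets by e. For each number, choose a point whose U contains the basic set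
    so numbered, or x0 if there is none. *)
Lemma lindelof (T : topologicalType) (U : T -> set T) (x0 : T) :
  @second_countable T -> (forall x, open (U x)) -> (forall x, U x x) ->
  exists xs : nat -> T, forall z, exists i, U (xs i) z.
Proof.
move=> [B /countable_injP[e einj] [_ Bb]] oU Ux.
pose P i := [set x | exists b, [/\ B b, e b = i & b `<=` U x]].
exists (fun i => xget x0 (P i)) => z.
have [b [Bbb bz] bU] : filter_from [set b | B b /\ b z] id (U z).
  by apply: Bb; exact: open_nbhs_nbhs.
exists (e b); have Pz : P (e b) z by exists b.
case: xgetP => [x _ [b' [Bb' eb' b'U]]|/(_ z Pz)//].
by apply: b'U; rewrite (einj b' b) ?inE.
Qed.

Section Bumps.
Variables (R : realType) (m : nat).

(** The argument is a squared Euclidean norm, which is smooth, unlike the sup norm of row vectors;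
    the support still lies in the closed sup-norm ball. *)
Definition ball_bump (a : 'rV[R]_m) (rho : R) (v : 'rV[R]_m) : R :=
  cutoff (\sum_j ((v 0 j - a 0 j) * rho^-1) * ((v 0 j - a 0 j) * rho^-1)).

Lemma ball_bump_center a rho : ball_bump a rho a = 1.
Proof.
by rewrite /ball_bump big1 ?cutoff_le0// => j _; rewrite subrr !mul0r.
Qed.

Lemma ball_bump_out a rho v : 0 < rho -> ball_bump a rho v != 0 ->
  closed_ball_ (fun v : 'rV[R]_m => `|v|) a rho v.
Proof.
move=> rho0 b0; have S1 : \sum_j ((v 0 j - a 0 j) / rho) * ((v 0 j - a 0 j) / rho) < 1.
  by rewrite ltNge; apply/negP => /cutoff_ge1 H; move: b0; rewrite /ball_bump H eqxx.
rewrite /closed_ball_ /= [leLHS]/Num.Def.normr/= mx_normrE.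
apply: bigmax_le => [|[i j] _]; first exact: ltW.
rewrite /= !mxE ord1 distrC leNgt; apply/negP => rv.
move: S1; rewrite (bigD1 j)//= ltNge => /negP; apply.
rewrite -[leLHS]addr0 lerD ?sumr_ge0// => [|k _]; last by rewrite -expr2 sqr_ge0.
rewrite -expr2 -real_normK ?num_real// normrM (ger0_norm (_ : 0 <= rho^-1)).
  by rewrite exprn_ege1// ler_pdivlMr// mul1r ltW.
by rewrite invr_ge0 ltW.
Qed.

Lemma smooth_ball_bump a rho : smooth (@dirs R m) setT (ball_bump a rho).
Proof.
move=> r; apply: (ckon_comp1 (g := @cutoff R)) openT _ _.
  exact: smooth_cutoff.
apply: ckon_sum openT _ => j.
have Hq : ckon (@dirs R m) r setT (fun v : 'rV[R]_m => (v 0 j - a 0 j) * rho^-1).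
  apply: ckonM openT _ _; last exact: ckon_cst.
  by apply: ckonB openT _ _; [exact: ckon_coord|exact: ckon_cst].
exact: (ckonM openT Hq Hq).
Qed.

Variable (M : manifold R m).

Definition smooth_scalar (u : M -> R) :=
  continuous u /\
  forall c, atlas M c -> smooth (@dirs R m) (crange c) (u \o cinv c).

(** Compactness is stated for superlevel sets since the compact sets of the cover are cut out by
    inequalities on such functions. *)
Lemma exists_bump (O : set M) x : open O -> O x ->
  exists c (u : M -> R), [/\ atlas M c, smooth_scalar u, u x = 1 &
    forall z, u z != 0 -> cdom c z /\ O z] /\
    forall eps, 0 < eps -> compact [set z | eps <= u z].
Proof.
move=> oO Ox; have [c Mc cx] := atlas_cover x.
have ic := atlas_chart Mc; have [oc orc cK cc ci] := ic.
have oV : open (cfun c @` (cdom c `&` O)).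
  by apply: open_chart_image; [done|exact: openI|exact: subIsetl].
have Vx : (cfun c @` (cdom c `&` O)) (cfun c x) by exists x.
have [rho /= rho0 Hrho] : exists2 rho : R, 0 < rho &
    closed_ball_ (fun v : 'rV[R]_m => `|v|) (cfun c x) rho `<=` cfun c @` (cdom c `&` O).
  have [d /= d0 Hd] := (nbhs_ballP _ _).1 (open_nbhs_nbhs (conj oV Vx)).
  exists (d / 2); first by rewrite divr_gt0.
  move=> v vd; apply: Hd; rewrite -ball_normE /ball_ /=.
  by apply: (le_lt_trans vd); rewrite ltr_pdivrMr// ltr_pMr// ltr1n.
set B := closed_ball_ (fun v : 'rV[R]_m => `|v|) (cfun c x) rho in Hrho.
have cB : compact B.
  apply: bounded_closed_compact; last exact: closed_closed_ball_.
  exists (`|cfun c x| + rho); split; first exact: num_real.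
  move=> N ltN v Bv; apply: le_trans (ltW ltN).
  rewrite -[v in leLHS](subrK (cfun c x)) addrC (le_trans (ler_normD _ _))//.
  by rewrite lerD2l distrC.
set K := cinv c @` B.
have KO z : K z -> cdom c z /\ O z.
  by move=> [v /Hrho[w [cw Ow] <-] <-]; rewrite cK.
have cK' : compact K.
  apply: continuous_compact cB; apply: continuous_in_subspaceT => v.
  rewrite inE => /Hrho[w [cw _] <-]; apply: ci; exact: chart_crange.
(* Here M is Hausdorff: the extension of the bump by 0 is continuous and smooth because the
   complement of K is open. *)
have clK : closed K by apply: compact_closed => //; exact: manifold_hausdorff.
pose q := ball_bump (cfun c x) rho.
pose u z : R := if `[< cdom c z >] then q (cfun c z) else 0.
have uK z : u z != 0 -> K z.
  rewrite /u; case: asboolP => [cz|_]; last by rewrite eqxx.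
  by move=> /ball_bump_out -/(_ rho0) Bz; exists (cfun c z) => //; rewrite cK.
have uE z : cdom c z -> q (cfun c z) = u z by rewrite /u => /asboolP ->.
have u0 z : (~` K) z -> 0 = u z.
  by move=> nK; apply/esym/eqP; apply: contrapT => /negP/uK.
have qc : continuous q by move=> v; exact: smooth_continuous (smooth_ball_bump _ _) Logic.I.
have uc : continuous u.
  move=> z; have [cz|ncz] := pselect (cdom c z).
    apply: (continuous_at_near oc cz uE).
    by apply: continuous_at_comp; [exact: cc|exact: qc].
  have nK : (~` K) z by move=> /KO[].
  apply: (continuous_at_near (f := cst 0) (closed_openC clK) nK u0).
  exact: cst_continuous.
exists c, u; split=> [|eps eps0]; last first.
  apply: (@subclosed_compact _ _ K) => //.
    have -> : [set z | eps <= u z] = u @^-1` [set t | eps <= t] by [].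
    by apply: closed_comp; [move=> z _; exact: uc|exact: closed_ge].
  by move=> z /= ez; apply: uK; rewrite gt_eqF// (lt_le_trans eps0).
split=> //; last by move=> z /uK /KO.
  split=> // c' Mc' r.
  have ic' := atlas_chart Mc'; have [oc' orc' cK'' cc' ci'] := ic'.
  have oV1 : open (cfun c' @` (cdom c' `&` cdom c)).
    by apply: open_chart_image; [done|exact: openI|exact: subIsetl].
  have oV2 : open (cfun c' @` (cdom c' `&` ~` K)).
    apply: open_chart_image; [done| |exact: subIsetl].
    by apply: openI => //; exact: closed_openC.
  apply: ckon_local => y [z cz' <-]; have [cz|ncz] := pselect (cdom c z).
    exists (cfun c' @` (cdom c' `&` cdom c)); first by exists z.
    apply: (@eq_ckon _ _ _ _ _ _ (q \o (cfun c \o cinv c'))) => //.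
      by move=> _ [w [cw' cw] <-] /=; rewrite cK''// uE.
    apply: (ckon_comp openT oV1) => //; first exact: smooth_ball_bump.
    move=> i; have /(smooth_onP _ oV1) := atlas_smooth Mc' Mc.
    by move=> /(_ i r).
  exists (cfun c' @` (cdom c' `&` ~` K)).
    by exists z => //; split=> // /KO[].
  apply: (@eq_ckon _ _ _ _ _ _ (cst 0)) => //; last exact: ckon_cst.
  by move=> _ [w [cw' nKw] <-] /=; rewrite cK''// -(u0 w).
by rewrite /u; case: asboolP => // _; exact: ball_bump_center.
Qed.

End Bumps.

Section AdaptedCover.
Variables (R : realType) (m n : nat) (M : manifold R m) (N : manifold R n).

(** Any countable cover will do here; local finiteness comes afterwards, by shrinking the domains to
    [level_dom]. *)
Record adapted_cover (f : M -> N) (c : nat -> chart R m M)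
    (d : nat -> chart R n N) (u : nat -> M -> R) : Prop := AdaptedCover {
  cover_atlas : forall i, atlas M (c i);
  cover_target : forall i, atlas N (d i);
  cover_smooth : forall i, smooth_scalar (u i);
  cover_supp : forall i z, u i z != 0 -> cdom (c i) z /\ cdom (d i) (f z);
  cover_compact : forall i eps, 0 < eps -> compact [set z | eps <= u i z];
  cover_all : forall z, exists i, 6 / 8 < u i z }.

Lemma exists_adapted_cover (f : M -> N) (x0 : M) : continuous f ->
  exists c d u, adapted_cover f c d u.
Proof.
move=> cf.
have H x : exists cdu : chart R m M * chart R n N * (M -> R),
    [/\ atlas M cdu.1.1, atlas N cdu.1.2, smooth_scalar cdu.2, cdu.2 x = 1 &
    forall z, cdu.2 z != 0 -> cdom cdu.1.1 z /\ cdom cdu.1.2 (f z)] /\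
    forall eps, 0 < eps -> compact [set z | eps <= cdu.2 z].
  have [d Nd dx] := atlas_cover (f x); have [od _ _ _ _] := atlas_chart Nd.
  have oO : open (f @^-1` cdom d) by apply: open_comp => // z _; exact: cf.
  have [c [u [[Mc su ux sp] cp]]] := exists_bump oO dx.
  by exists (c, d, u).
have [F HF] := choice H.
pose U x := [set z | 6 / 8 < (F x).2 z].
have oU x : open (U x).
  have [[_ _ [cu _] _ _] _] := HF x.
  have -> : U x = (F x).2 @^-1` [set t | 6 / 8 < t] by [].
  by apply: open_comp => [z _|]; [exact: cu|exact: open_gt].
have Ux x : U x x by have [[_ _ _ E _] _] := HF x; rewrite /U /= E; lra.
have [xs Hxs] := lindelof x0 (@manifold_second_countable _ _ M) oU Ux.
exists (fun i => (F (xs i)).1.1), (fun i => (F (xs i)).1.2), (fun i => (F (xs i)).2).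
by split=> // i; have [[]] := HF (xs i).
Qed.

End AdaptedCover.

Section CoverSets.
Variables (R : realType) (m n : nat) (M : manifold R m) (N : manifold R n).
Variables (f : M -> N) (c : nat -> chart R m M) (d : nat -> chart R n N)
  (u : nat -> M -> R).
Hypothesis AC : adapted_cover f c d u.
Implicit Types (i : nat) (x z : M).

Let uc i : continuous (u i). Proof. by have [] := cover_smooth AC i. Qed.

(* level_closed <= level_open <= level_compact <= level_dom; the cores
   6 / 8 <= u j of the earlier charts are removed from level_dom, which makes
   the family locally finite without any exhaustion of M by compact sets. *)
Definition level_compact i :=
  [set z | 1 / 8 <= u i z /\ forall j : 'I_i, u j z <= 5 / 8].
Definition level_open i :=
  [set z | 1 / 8 < u i z /\ forall j : 'I_i, u j z < 5 / 8].
Definition level_closed i :=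
  [set z | 2 / 8 <= u i z /\ forall j : 'I_i, u j z <= 4 / 8].
Definition level_dom i :=
  [set z | cdom (c i) z /\ forall j : 'I_i, u j z < 6 / 8].

Lemma level_open_compact i : level_open i `<=` level_compact i.
Proof. by move=> z [uz ujz]; split=> [|j]; rewrite ltW. Qed.

Lemma level_closed_open i : level_closed i `<=` level_open i.
Proof.
move=> z [uz ujz]; split=> [|j]; first by apply: lt_le_trans uz; lra.
by apply: (le_lt_trans (ujz j)); lra.
Qed.

Lemma level_compact_dom i : level_compact i `<=` level_dom i.
Proof.
move=> z [uz ujz]; split=> [|j]; last by apply: (le_lt_trans (ujz j)); lra.
by have [] := @cover_supp _ _ _ _ _ _ _ _ _ AC i z; first by rewrite gt_eqF//; lra.
Qed.

Lemma level_compact_target i z : level_compact i z -> cdom (d i) (f z).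
Proof.
move=> [uz _]; have [] := @cover_supp _ _ _ _ _ _ _ _ _ AC i z => //.
by rewrite gt_eqF//; lra.
Qed.

Lemma level_compact_source i z : level_compact i z -> cdom (c i) z.
Proof. by move=> /level_compact_dom[]. Qed.

Let open_lt_all i r : open [set z | forall j : 'I_i, u j z < r].
Proof.
rewrite openE => z Hz; apply: filter_forall => j.
exact: (cvgr_lt _ (@uc j z)).
Qed.

Let closed_le_all i r : closed [set z | forall j : 'I_i, u j z <= r].
Proof.
have -> : [set z | forall j : 'I_i, u j z <= r] =
    \bigcap_(j in [set: 'I_i]) (u j @^-1` [set t | t <= r]).
  by apply/seteqP; split=> z Hz => [j _|j]; [exact: Hz|exact: (Hz j)].
apply: closed_bigI => j _; apply: closed_comp => [z _|]; first exact: uc.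
exact: closed_le.
Qed.

Let closed_ge1 i r : closed [set z | r <= u i z].
Proof.
have -> : [set z | r <= u i z] = u i @^-1` [set t | r <= t] by [].
by apply: closed_comp => [z _|]; [exact: uc|exact: closed_ge].
Qed.

Lemma open_level_open i : open (level_open i).
Proof.
have oi : open (u i @^-1` [set t | 1 / 8 < t]).
  by apply: open_comp => [z _|]; [exact: uc|exact: open_gt].
exact: openI oi (@open_lt_all i (5 / 8)).
Qed.

Lemma open_level_dom i : open (level_dom i).
Proof.
have [oi _ _ _ _] := atlas_chart (cover_atlas AC i).
exact: openI oi (@open_lt_all i (6 / 8)).
Qed.

Lemma closed_level_closed i : closed (level_closed i).
Proof. by apply: closedI; [exact: closed_ge1|exact: closed_le_all]. Qed.

Lemma compact_level_compact i : compact (level_compact i).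
Proof.
have p : 0 < 1 / 8 :> R by lra.
by apply: compact_closedI; [exact: cover_compact AC i _ p|exact: closed_le_all].
Qed.

Lemma closed_level_compact i : closed (level_compact i).
Proof. by apply: closedI; [exact: closed_ge1|exact: closed_le_all]. Qed.

Lemma level_dom_finite z :
  exists W k, [/\ open W, W z & forall i x, (k <= i)%N -> W x -> ~ level_dom i x].
Proof.
have [k uk] := cover_all AC z.
exists (u k @^-1` [set t | 6 / 8 < t]), k.+1; split=> //.
  by apply: open_comp => [x _|]; [exact: uc|exact: open_gt].
move=> i x ki /= ux [_ /(_ (Ordinal ki))] /=.
by rewrite ltNge (ltW ux).
Qed.

(** The first factor goes from 0 at u i = 2/8 to 1 at 3/8, each other one from 1 at u j = 3/8 to 0
    at 4/8. So the weight is supported in [level_closed i] and equals 1 at points where i is the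
    first index with u i >= 3/8. *)
Definition weight i z : R :=
  (1 - cutoff (8 * u i z - 2)) * \prod_(j < i) cutoff (8 * u j z - 3).

Lemma weight_ge0 i z : 0 <= weight i z.
Proof.
rewrite mulr_ge0 ?subr_ge0 ?cutoff_le1//.
by apply: prodr_ge0 => j _; exact: cutoff_ge0.
Qed.

Lemma weight_le1 i z : weight i z <= 1.
Proof.
rewrite /weight -[leRHS]mulr1; apply: ler_pM.
- by rewrite subr_ge0 cutoff_le1.
- by apply: prodr_ge0 => j _; exact: cutoff_ge0.
- by rewrite gerBl cutoff_ge0.
- apply: prodr_ile1 => j _; by rewrite cutoff_ge0 cutoff_le1.
Qed.

Lemma weight_out i z : ~ level_closed i z -> weight i z = 0.
Proof.
move=> nC; apply/eqP; rewrite mulf_eq0; apply/orP.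
have [u2|u2] := leP (2 / 8) (u i z); last first.
  by left; rewrite cutoff_le0 ?subrr//; lra.
right; apply/prodf_eq0; apply: contrapT => H; apply: nC; split=> // j.
rewrite leNgt; apply/negP => uj; apply: H; exists j => //.
by rewrite cutoff_ge1//; lra.
Qed.

(** The weights are not a partition of unity: each point only has to be moved all the way by one
    stage. *)
Lemma weight_eq1 z : exists i, weight i z = 1.
Proof.
have ex : exists i, 3 / 8 <= u i z.
  by have [i ui] := cover_all AC z; exists i; lra.
exists (ex_minn ex); case: ex_minnP => i ui imin.
rewrite /weight cutoff_ge1; last by lra.
rewrite subr0 mul1r big1// => j _; apply: cutoff_le0.
have : ~~ (3 / 8 <= u j z) by apply/negP => /imin; rewrite leqNgt ltn_ord.
by rewrite -ltNge; lra.
Qed.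

Lemma smooth_weight i :
  smooth (@dirs R m) (crange (c i)) (weight i \o cinv (c i)).
Proof.
have [_ oW _ _ _] := atlas_chart (cover_atlas AC i).
have Su j a r : ckon (@dirs R m) r (crange (c i))
    (fun v => cutoff (8 * u j (cinv (c i) v) - a)).
  apply: (ckon_comp1 (g := @cutoff R)) => //; first exact: smooth_cutoff.
  apply: ckonB => //; last exact: ckon_cst.
  apply: ckonM => //; first exact: ckon_cst.
  by have [_ /(_ _ (cover_atlas AC i) r)] := cover_smooth AC j.
move=> r; apply: ckonM => //.
  by apply: ckonB => //; exact: ckon_cst.
by apply: ckon_prod => // j; exact: Su.
Qed.

End CoverSets.

(** * Moving a map to a nearby one, chart after chart *)

Section Stages.
Variables (R : realType) (m n : nat) (M : manifold R m) (N : manifold R n).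
Variables (f : M -> N) (c : nat -> chart R m M) (d : nat -> chart R n N)
  (u : nat -> M -> R).
Hypothesis AC : adapted_cover f c d u.
Implicit Types (i k : nat) (x : M) (y z : N) (mu : R).

(* Stage i moves z towards f x + mu (y - f x), computed in the chart d i, and
   not towards y with a factor mu: for mu a bump in time this target is already
   a smooth curve, so no flatness of the previous stages is needed. *)
Definition blend i mu x y z : 'rV[R]_n :=
  (1 - weight u i x) *: cfun (d i) z + weight u i x *:
    (cfun (d i) (f x) + mu *: (cfun (d i) y - cfun (d i) (f x))).

(** The test guards the use of the chart d i, which is known to contain f x only over
    [level_compact u i]. It creates no jump, since the weight already vanishes off the smaller set
    [level_closed u i]. *)
Fixpoint stage k mu x y : N :=
  if k is i.+1 then
    if `[< level_compact u i x >] then cinv (d i) (blend i mu x y (stage i mu x y))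
    else stage i mu x y
  else f x.

(** All blends at x are computed inside the charts. Stages are defined pointwise, so this is a
    condition on the pair (x, y) and can be ensured by a neighbourhood of (x, f x). *)
Definition admissible x y := forall i mu, level_compact u i x -> 0 <= mu <= 1 ->
  [/\ cdom (d i) y, cdom (d i) (stage i mu x y) &
    crange (d i) (blend i mu x y (stage i mu x y))].

Let dK i z : cdom (d i) z -> cinv (d i) (cfun (d i) z) = z.
Proof. by have [_ _ K _ _] := atlas_chart (cover_target AC i); exact: K. Qed.

Lemma stage0 k x y : stage k 0 x y = f x.
Proof.
elim: k => //= i ->; case: asboolP => // Kx.
rewrite /blend scale0r addr0 -scalerDl subrK scale1r dK//.
exact: (level_compact_target AC Kx).
Qed.

Lemma stage_closed i mu x y : admissible x y -> 0 <= mu <= 1 ->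
  ~ level_closed u i x -> stage i.+1 mu x y = stage i mu x y.
Proof.
move=> ad mu01 nC /=; case: asboolP => // Kx.
have [_ sd _] := ad i mu Kx mu01.
by rewrite /blend weight_out// subr0 scale1r scale0r addr0 dK.
Qed.

(** For mu = 1 the target of every blend is y. Stage i, of weight 1, lands on it, and later stages
    blend y with itself. *)
Lemma stage1 i k x y : admissible x y -> weight u i x = 1 -> (i < k)%N ->
  stage k 1 x y = y.
Proof.
move=> ad w1; elim: k => // k IH; rewrite ltnS leq_eqVlt.
have b1 : (0 : R) <= (1 : R) <= (1 : R) by rewrite ler01 lexx.
move=> /orP[/eqP<-|/IH E] /=; case: asboolP => Kx.
- have [yd _ _] := ad i 1 Kx b1.
  by rewrite /blend w1 subrr scale0r add0r !scale1r addrC subrK dK.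
- exfalso; apply: Kx; apply: level_open_compact; apply: level_closed_open.
  by apply: contrapT => /weight_out w0; move: w1; rewrite w0 => /eqP; rewrite eq_sym oner_eq0.
- have [yd _ _] := ad k 1 Kx b1.
  by rewrite /blend E scale1r [_ + (_ - _)]addrC subrK -scalerDl subrK scale1r dK.
- exact: E.
Qed.

Lemma stage_stable k l mu x y : (forall i, (k <= i)%N -> ~ level_compact u i x) ->
  (k <= l)%N -> stage l mu x y = stage k mu x y.
Proof.
move=> H; elim: l => [|l IH]; first by rewrite leqn0 => /eqP->.
rewrite leq_eqVlt => /orP[/eqP->//|]; rewrite ltnS => kl /=.
by case: asboolP => [/(H _ kl)//|_]; exact: IH.
Qed.

(** The point is the convex combination of z, w and y with coefficients 1 - s, s (1 - mu) and s mu,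
    and balls are convex. The cases s < 1, mu < 1 and s = mu = 1 exhibit a positive coefficient, for
    the strict inequality. *)
Lemma norm_blend (a y z w : 'rV[R]_n) (s mu rho : R) :
  0 <= s <= 1 -> 0 <= mu <= 1 ->
  `|a - y| < rho -> `|a - z| < rho -> `|a - w| < rho ->
  `|a - ((1 - s) *: z + s *: (w + mu *: (y - w)))| < rho.
Proof.
move=> /andP[s0 s1] /andP[mu0 mu1] ay az aw.
have -> : a - ((1 - s) *: z + s *: (w + mu *: (y - w))) =
  (1 - s) *: (a - z) + (s * (1 - mu)) *: (a - w) + (s * mu) *: (a - y).
  by apply/rowP => j; rewrite !mxE; ring.
have rho0 : 0 <= rho by exact: ltW (le_lt_trans (normr_ge0 _) ay).
rewrite (le_lt_trans (ler_normD _ _))//.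
rewrite (le_lt_trans (lerD (ler_normD _ _) (lexx _)))//.
rewrite !normrZ !ger0_norm ?mulr_ge0 ?subr_ge0//.
move: (`|a - y|) (`|a - z|) (`|a - w|) ay az aw => p q r pr qr rr.
have m1 : (1 - s) * q <= (1 - s) * rho by rewrite ler_wpM2l ?subr_ge0// ltW.
have m2 : s * (1 - mu) * r <= s * (1 - mu) * rho.
  by rewrite ler_wpM2l ?mulr_ge0 ?subr_ge0// ltW.
have m3 : s * mu * p <= s * mu * rho by rewrite ler_wpM2l ?mulr_ge0// ltW.
have [s1'|s1'] := ltP s 1.
  have m1' : (1 - s) * q < (1 - s) * rho by rewrite ltr_pM2l// subr_gt0.
  nra.
have {s1 s1'} -> : s = 1 by apply: le_anti; rewrite s1 s1'.
have [mu1'|mu1'] := ltP mu 1.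
  have m2' : (1 - mu) * r < (1 - mu) * rho by rewrite ltr_pM2l// subr_gt0.
  have m3' : mu * p <= mu * rho by rewrite ler_wpM2l// ltW.
  nra.
have -> : mu = 1 by apply: le_anti; rewrite mu1 mu1'.
by rewrite subrr !mul1r !mul0r !add0r.
Qed.

(** Continuity of one stage at f x, uniformly in mu. If x is in [level_compact u i], Z corresponds
    to a ball in the chart d i, which is stable under blending; otherwise a neighbourhood of x
    avoids this closed set. *)
Let step_near i x (Y : set N) : nbhs (f x) Y -> exists O Z,
  [/\ nbhs x O, nbhs (f x) Z, Z `<=` Y &
    forall x' y z mu, O x' -> level_compact u i x' -> Z y -> Z z -> Z (f x') ->
      0 <= mu <= 1 -> [/\ cdom (d i) y, cdom (d i) z,
        crange (d i) (blend i mu x' y z) & Y (cinv (d i) (blend i mu x' y z))]].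
Proof.
move=> nY; have [Kx|nKx] := pselect (level_compact u i x); last first.
  exists (~` level_compact u i), Y; split=> //.
  apply: open_nbhs_nbhs; split=> //; apply: closed_openC.
  exact: closed_level_compact AC i.
have [od ord dK' dc di] := atlas_chart (cover_target AC i).
have dfx := level_compact_target AC Kx.
have nV : nbhs (cfun (d i) (f x)) (crange (d i) `&` cinv (d i) @^-1` Y).
  apply: filterI; first by apply: open_nbhs_nbhs; split=> //; exact: chart_crange.
  by apply: (di _ (chart_crange dfx)); rewrite dK'.
have [rho /= rho0 Hrho] := (nbhs_ballP _ _).1 nV.
exists setT, (Y `&` (cdom (d i) `&` cfun (d i) @^-1` ball (cfun (d i) (f x)) rho)).
split.
- exact: filterT.
- apply: filterI => //; apply: filterI; first exact: open_nbhs_nbhs.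
  by apply: (dc _ dfx); exact: nbhsx_ballx.
- by move=> y [].
- move=> x' y z mu _ _ [_ [dy By]] [_ [dz Bz]] [_ [dx' Bx']] mu01.
  have /Hrho[? ?] : ball (cfun (d i) (f x)) rho (blend i mu x' y z).
    rewrite -ball_normE /ball_ /=; apply: norm_blend => //.
    - by rewrite weight_ge0 weight_le1.
    - by move: By; rewrite /= -ball_normE.
    - by move: Bz; rewrite /= -ball_normE.
    - by move: Bx'; rewrite /= -ball_normE.
  by split.
Qed.

(** Works backwards: a neighbourhood prescribed for the result of the last stage is shrunk by
    [step_near] to one for the stage before, down to the initial value f x. *)
Let stage_near k x (Y : set N) : nbhs (f x) Y -> exists O Z,
  [/\ nbhs x O, nbhs (f x) Z, Z `<=` Y &
    forall x' y mu, O x' -> Z (f x') -> Z y -> 0 <= mu <= 1 ->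
      Y (stage k mu x' y) /\ forall i, (i < k)%N -> level_compact u i x' ->
      [/\ cdom (d i) y, cdom (d i) (stage i mu x' y) &
        crange (d i) (blend i mu x' y (stage i mu x' y))]].
Proof.
elim: k Y => [|k IH] Y nY.
  by exists setT, Y; split=> //; exact: filterT.
have [ O1 [Z1 [nO1 nZ1 Z1Y H1]]] := step_near k nY.
have [ O2 [Z2 [nO2 nZ2 Z21 H2]]] := IH _ nZ1.
exists (O1 `&` O2), Z2; split=> //; [exact: filterI|by move=> y /Z21/Z1Y|].
move=> x' y mu [Ox1 Ox2] Zx Zy mu01.
have [Ys Hs] := H2 x' y mu Ox2 Zx Zy mu01.
split=> [/=|i].
  case: asboolP => [Kx|_]; last exact: Z1Y.
  by have [] := H1 x' y _ mu Ox1 Kx (Z21 _ Zy) Ys (Z21 _ Zx) mu01.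
rewrite ltnS leq_eqVlt => /orP[/eqP-> Kx|]; last exact: Hs.
by have [] := H1 x' y _ mu Ox1 Kx (Z21 _ Zy) Ys (Z21 _ Zx) mu01.
Qed.

(** Near x only finitely many stages act, by [level_dom_finite], so finitely many shrinkings in
    [stage_near] are enough. *)
Lemma admissible_near x : {for x, continuous f} ->
  exists O Z, [/\ nbhs x O, nbhs (f x) Z & forall x' y, O x' -> Z y -> admissible x' y].
Proof.
move=> cf; have [W [k [oW Wx Hk]]] := level_dom_finite AC x.
have [ O [Z [nO nZ _ H]]] := stage_near k (filterT : nbhs (f x) setT).
exists (O `&` (f @^-1` Z) `&` W), Z; split=> //.
  by apply: filterI; [apply: filterI => //; exact: cf|exact: open_nbhs_nbhs].
move=> x' y [[Ox' Zx'] Wx'] Zy i mu Kx mu01.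
have [_ Hs] := H x' y mu Ox' Zx' Zy mu01; apply: Hs => //.
rewrite ltnNge; apply/negP => ki; apply: (Hk i x' ki Wx').
exact: (level_compact_dom AC Kx).
Qed.

(* The compact sets being fixed once and for all, a chartwise C^0 bound on each
   of them confines the graph of y to the admissible neighbourhood. *)
Lemma admissible_radius i : (forall x, {for x, continuous f}) ->
  exists2 del : R, 0 < del & forall x y, level_compact u i x -> cdom (d i) y ->
    `|cfun (d i) (f x) - cfun (d i) y| < del -> admissible x y.
Proof.
move=> cf.
have [od ord dK' dc di] := atlas_chart (cover_target AC i).
have /compact_near_coveringP cov := compact_level_compact (i := i) AC.
have H : \forall e \near (0 : R)^'+, level_compact u i `<=`
    [set x | forall y, cdom (d i) y ->
      `|cfun (d i) (f x) - cfun (d i) y| < e -> admissible x y].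
  apply: cov => x Kx; have [ O [Z [nO nZ HOZ]]] := admissible_near (cf x).
  have dfx := level_compact_target AC Kx.
  have nV : nbhs (cfun (d i) (f x)) (crange (d i) `&` cinv (d i) @^-1` Z).
    apply: filterI; first by apply: open_nbhs_nbhs; split=> //; exact: chart_crange.
    by apply: (di _ (chart_crange dfx)); rewrite dK'.
  have [rho /= rho0 Hrho] := (nbhs_ballP _ _).1 nV.
  have cdf : {for x, continuous (cfun (d i) \o f)}.
    by apply: continuous_at_comp; [exact: cf|exact: dc].
  have n1 : \forall x' \near x,
      `|cfun (d i) (f x) - cfun (d i) (f x')| < rho / 2.
    by move/cvgrPdist_lt : cdf => /(_ (rho / 2)); apply; rewrite divr_gt0.
  have n2 : \forall e \near (0 : R)^'+, e < rho / 2.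
    by apply: nbhs_right_lt; rewrite divr_gt0.
  exists ([set x' | O x' /\ `|cfun (d i) (f x) - cfun (d i) (f x')| < rho / 2],
          [set e | e < rho / 2]).
    by split=> //=; exact: filterI.
  move=> [x' e] /= [[Ox' x'x] er] y dy ye; apply: HOZ => //.
  have /Hrho[_ /=] : ball (cfun (d i) (f x)) rho (cfun (d i) y).
    rewrite -ball_normE /ball_ /=.
    apply: (le_lt_trans (ler_distD (cfun (d i) (f x')) _ _)).
    by rewrite [ltRHS]splitr ltrD// (lt_trans ye).
  by rewrite dK'.
have [e [He e0]] : exists e : R, (level_compact u i `<=`
    [set x | forall y, cdom (d i) y ->
      `|cfun (d i) (f x) - cfun (d i) y| < e -> admissible x y]) /\ 0 < e.
  have H0 : \forall e \near (0 : R)^'+, 0 < e by exact: nbhs_right_gt.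
  by have := filter_ex (filterI H H0); case=> e []; exists e.
by exists e => // x y Kx dy; exact: He.
Qed.

End Stages.

Lemma dpartB (R : realType) (V : normedModType R) (I : Type) (e : I -> V)
    (W : set V) (g h : V -> R) s x : open W -> smooth e W g -> smooth e W h -> W x ->
  dpart e s (fun y => g y - h y) x = dpart e s g x - dpart e s h x.
Proof.
move=> oW Sg Sh; elim: s x => //= j s IH x Wx.
have nE : \forall y \near x, dpart e s (fun y => g y - h y) y =
    (dpart e s g - dpart e s h) y.
  by near=> y; apply: IH; near: y; exact: open_nbhs_nbhs.
rewrite (near_eq_derive _ nE) deriveB//.
  exact: smooth_derivable (smooth_dpart s Sg) Wx.
exact: smooth_derivable (smooth_dpart s Sh) Wx.
Unshelve. all: by end_near. Qed.

Lemma smooth_wrt_in (R : realType) m n (T S : topologicalType)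
    (A : set (chart R m T)) (B : set (chart R n S)) (f : T -> S) O :
  (forall x, exists2 c, A c & cdom c x) -> smooth_wrt A B f -> smooth_in A B f O.
Proof.
move=> cov [cf Sf]; split=> [x _|c d Ac Bd].
  by have [c Ac cx] := cov x; exact: cf Ac cx.
by apply: smooth_onW (Sf c d Ac Bd); apply: image_subset => x [[]].
Qed.

Lemma prod_chart_image (R : realType) m (M : manifold R m) (c : chart R m M) (O : set M) :
  cfun (prod_chart (k := 1) setT c) @` (snd @^-1` O) =
  @rsubmx R 1 1 m @^-1` (cfun c @` O).
Proof.
apply/seteqP; split=> [y [[t x] Ox <-]|y [x Ox E]] /=.
  by rewrite row_mxKr; exists x.
by exists (lsubmx y, x) => //=; rewrite E hsubmxK.
Qed.

Lemma slot_weight_bounds (R : realType) (t : R) : 0 <= slot_weight t <= 1.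
Proof. by rewrite cutoff_ge0 cutoff_le1. Qed.

Lemma slot_weight_mid (R : realType) k : slot_weight (slot_mid R k) = 1.
Proof. by rewrite /slot_weight slot_of_mid slot_bump_mid. Qed.

Lemma slot_weight0 (R : realType) : slot_weight (0 : R) = 0.
Proof.
by rewrite /slot_weight slot_bump_out// negb_and -ltNge slot_lo_gt0.
Qed.

(** * The smooth curve through f and all the g k *)

Section Curve.
Variables (R : realType) (m n : nat) (M : manifold R m) (N : manifold R n).
Variables (f : Cinf M N) (c : nat -> chart R m M) (d : nat -> chart R n N)
  (u : nat -> M -> R).
Hypothesis AC : adapted_cover f c d u.
Variables (g : nat -> Cinf M N) (eps : nat -> R).
Hypothesis adm : forall k x, admissible f d u x (g k x).
Hypothesis eps_gt0 : forall k, 0 < eps k.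
Hypothesis eps_slot : forall k l t, (l <= k)%N ->
  `|dpart (@dir1 R) (nseq l tt) (slot_bump k) t| * eps k <= slot_lo R k ^+ 2.
Hypothesis close : forall i k s (l : 'I_n) v, (size s <= k)%N ->
  (cfun (c i) @` level_compact u i) v ->
  `|dpart (@dirs R m) s (fun v => (cfun (d i) \o f \o cinv (c i)) v 0 l) v -
    dpart (@dirs R m) s (fun v => (cfun (d i) \o g k \o cinv (c i)) v 0 l) v| <= eps k.

Lemma cinf_continuous (h : Cinf M N) x : {for x, continuous h}.
Proof.
by have [e Me ex] := atlas_cover x; have [ch _] := cinf_smooth h; exact: ch Me ex.
Qed.

(** Between slots the weight is 0, so by [stage0] the value is f whatever index [slot_of]
    returns. *)
Definition curve_stage i (p : 'rV[R]_1 * M) : N :=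
  stage f d u i (slot_weight (p.1 0 0)) p.2 (g (slot_of (p.1 0 0)) p.2).

Let prod_cover (p : 'rV[R]_1 * M) :
  exists2 e, prod_atlas setT M e & cdom e p.
Proof.
have [e Me ex] := atlas_cover p.2.
by exists (prod_chart setT e) => //; exists e.
Qed.

Let open_snd (O : set M) : open O -> open (@snd 'rV[R]_1 M @^-1` O).
Proof. by move=> oO; apply: open_comp => // p _; exact: cvg_snd. Qed.

Let open_level_image i : open (cfun (c i) @` level_open u i).
Proof.
apply: open_chart_image; first exact: atlas_chart (cover_atlas AC i).
  exact: (open_level_open AC).
by move=> x /level_open_compact /(level_compact_source AC).
Qed.

Let open_time_image i : open (@rsubmx R 1 1 m @^-1` (cfun (c i) @` level_open u i)).
Proof.
by apply: open_comp => [y _|]; [exact: rsubmx_continuous|exact: open_level_image].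
Qed.

Let smooth_level (h : Cinf M N) i :
  (forall x, level_compact u i x -> cdom (d i) (h x)) ->
  forall l, smooth (@dirs R m) (cfun (c i) @` level_open u i)
    (fun v => (cfun (d i) \o h \o cinv (c i)) v 0 l).
Proof.
move=> Hh; apply/smooth_onP; first exact: open_level_image.
have [_ Sh] := cinf_smooth h.
apply: smooth_onW (Sh _ _ (cover_atlas AC i) (cover_target AC i)).
apply: image_subset => x /level_open_compact Kx; split; last exact: Hh.
exact: (level_compact_source AC Kx).
Qed.

Lemma smooth_curve_stage0 : smooth_wrt (prod_atlas setT M) (atlas N) (curve_stage 0).
Proof.
apply: smooth_wrt_local.
- exact: compatible_prod.
- exact: compatible_atlas.
move=> [t x]; have [e Me ex] := atlas_cover x.
have [e' Ne' ex'] := atlas_cover (f x).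
have [oe _ _ _ _] := atlas_chart Me; have [oe' _ _ _ _] := atlas_chart Ne'.
have oO : open (cdom e `&` f @^-1` cdom e').
  by apply: open_preimage_in => // y _; exact: cinf_continuous.
exists (snd @^-1` (cdom e `&` f @^-1` cdom e')), (curve_stage 0); split=> //.
  exact: open_snd.
apply: (smooth_in_chart (@compatible_prod _ _ M) (@compatible_atlas _ _ N)
  (c0 := prod_chart setT e) (d0 := e')) => //.
- by exists e.
- exact: open_snd.
- by move=> [s y] [].
- by move=> [s y] [].
rewrite prod_chart_image.
have oi : open (cfun e @` (cdom e `&` f @^-1` cdom e')).
  by apply: open_chart_image; [exact: atlas_chart|done|exact: subIsetl].
apply: (smooth_on_comp (g := @rsubmx R 1 1 m) (h := cfun e' \o f \o cinv e) _ oi) => //.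
- by apply: open_comp => // y _; exact: rsubmx_continuous.
- by apply: smooth_on_rsubmx; apply: open_comp => // y _; exact: rsubmx_continuous.
- by have [_ Sf] := cinf_smooth f; exact: Sf.
Qed.

(** Two open sets cover M: off [level_closed u i] nothing changes, and over [level_open u i] the new
    stage is, in charts, a blend with smooth coefficients of the previous stage and of the target in
    time. *)
Lemma smooth_curve_stageS i :
  smooth_wrt (prod_atlas setT M) (atlas N) (curve_stage i) ->
  smooth_wrt (prod_atlas setT M) (atlas N) (curve_stage i.+1).
Proof.
move=> Sz; apply: smooth_wrt_local.
- exact: compatible_prod.
- exact: compatible_atlas.
move=> [t x]; have [Cx|nCx] := pselect (level_closed u i x); last first.
  exists (snd @^-1` (~` level_closed u i)), (curve_stage i); split=> //.
  - by apply: open_snd; apply: closed_openC; exact: (closed_level_closed AC).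
  - move=> [s y] /= nC; rewrite /curve_stage; apply/esym.
    by apply: (stage_closed AC (@adm _ _)) => //; exact: slot_weight_bounds.
  - exact: smooth_wrt_in.
have Mi := cover_atlas AC i; have Ni := cover_target AC i.
have iM := atlas_chart Mi; have iN := atlas_chart Ni.
exists (snd @^-1` level_open u i), (curve_stage i.+1); split=> //.
- by apply: open_snd; exact: (open_level_open AC).
- exact: level_closed_open.
have ad (s : R) y := @adm (slot_of s) y i (slot_weight s) ^~ (slot_weight_bounds s).
apply: (smooth_in_chart (@compatible_prod _ _ M) (@compatible_atlas _ _ N)
  (c0 := prod_chart setT (c i)) (d0 := d i)) => //.
- by exists (c i).
- by apply: open_snd; exact: (open_level_open AC).
- by move=> [s y] /level_open_compact Ky; split=> //; exact: (level_compact_source AC Ky).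
- move=> [s y] /level_open_compact Ky; rewrite /curve_stage /=; case: asboolP => // _.
  have [_ _ cr] := ad (s 0 0) y Ky.
  exact: chart_cinv_dom cr.
rewrite prod_chart_image.
set V := cfun (c i) @` level_open u i; set W := _ @^-1` V.
have oW : open W by exact: open_time_image.
have oV : open V by exact: open_level_image.
pose z' := cfun (d i) \o curve_stage i \o cinv (prod_chart (k := 1) setT (c i)).
have Sz' l : smooth (@dirs R (1 + m)) W (fun y => z' y 0 l).
  move: l; apply/(smooth_onP _ oW); have [_ Sz''] := Sz.
  have Mi' : prod_atlas (k := 1) setT M (prod_chart setT (c i)) by exists (c i).
  apply: smooth_onW (Sz'' _ _ Mi' Ni); rewrite /W /V -prod_chart_image.
  apply: image_subset => -[s y] /level_open_compact Ky; split.
    by split=> //; exact: (level_compact_source AC Ky).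
  by have [_ ? _] := ad (s 0 0) y Ky.
pose F (h : M -> N) v : 'rV[R]_n := cfun (d i) (h (cinv (c i) v)).
have Sf l : smooth (@dirs R m) V (fun v => F f v 0 l).
  by apply: smooth_level => y Ky; exact: (level_compact_target AC Ky).
have Sg k l : smooth (@dirs R m) V (fun v => F (g k) v 0 l).
  apply: smooth_level => y Ky.
  have b0 : (0 : R) <= (0 : R) <= (1 : R) by rewrite lexx ler01.
  by have [] := @adm k y i 0 Ky b0.
(* The target jumps from one g k to another with time; this is the place where the rapid decay of
   the differences is used. *)
have Se l : smooth (@dirs R (1 + m)) W (fun y => slot_weight (time y) *
    (F (g (slot_of (time y))) (rsubmx y) 0 l - F f (rsubmx y) 0 l)).
  apply: (smooth_slots (E := fun k v => F (g k) v 0 l - F f v 0 l) eps_gt0 eps_slot) => //.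
    by move=> k r; apply: (ckonB oV); [exact: Sg|exact: Sf].
  move=> k s v sk Vv; rewrite (dpartB s oV (Sg k l) (Sf l) Vv) distrC.
  apply: close => //; apply: image_subset Vv; exact: level_open_compact.
pose b (y : 'rV[R]_(1 + m)) := weight u i (cinv (c i) (rsubmx y)).
have Sb r : ckon (@dirs R (1 + m)) r W b.
  apply: (ckon_rsubmx (g := weight u i \o cinv (c i))) => //.
  apply: ckonW (smooth_weight AC i r) => _ [y /level_open_compact Ky <-].
  by apply: chart_crange; exact: (level_compact_source AC Ky).
apply/(smooth_onP _ oW) => l r.
apply: (@eq_ckon _ _ _ _ _ _ (fun y => (1 - b y) * z' y 0 l + b y *
    (F f (rsubmx y) 0 l + slot_weight (time y) *
    (F (g (slot_of (time y))) (rsubmx y) 0 l - F f (rsubmx y) 0 l)))) => //.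
  move=> y [x' /level_open_compact Kx' E] /=.
  rewrite /curve_stage /= -E.
  have [_ _ K _ _] := iM; rewrite K; last exact: (level_compact_source AC Kx').
  case: asboolP => // _; rewrite chart_cinvK//; last first.
    by have [] := ad (time y) x' Kx'.
  rewrite /blend !mxE /z' /b /F /= -E K; last exact: (level_compact_source AC Kx').
  by rewrite /curve_stage /time /= !mxE.
apply: (ckonD oW).
  apply: (ckonM oW); last exact: Sz'.
  by apply: (ckonB oW); [exact: ckon_cst|exact: Sb].
apply: (ckonM oW) => //; apply: ckonD oW _ _; last exact: Se.
by apply: (ckon_rsubmx (g := fun v => F f v 0 l)) => //; exact: Sf.
Qed.

Lemma smooth_curve_stage i : smooth_wrt (prod_atlas setT M) (atlas N) (curve_stage i).
Proof. by elim: i => [|i IH]; [exact: smooth_curve_stage0|exact: smooth_curve_stageS]. Qed.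

Lemma exists_smooth_curve : exists z : 'rV[R]_1 * M -> N,
  [/\ smooth_wrt (prod_atlas setT M) (atlas N) z,
      forall x, z (0, x) = f x &
      forall k x, z ((slot_mid R k)%:M, x) = g k x].
Proof.
have H (x : M) : exists k, forall i, (k <= i)%N -> ~ level_compact u i x.
  have [W [k [_ Wx Hk]]] := level_dom_finite AC x.
  exists k => i ki Kx; apply: (Hk i x ki Wx); exact: (level_compact_dom AC Kx).
have [k0 Hk0] := choice H.
(* k0 is chosen point by point, without any continuity; near each point it can be replaced by a
   fixed number of stages, because the later ones do nothing there. *)
exists (fun p => curve_stage (k0 p.2) p); split.
- apply: smooth_wrt_local.
  + exact: compatible_prod.
  + exact: compatible_atlas.
  move=> [t x]; have [W [k [oW Wx Hk]]] := level_dom_finite AC x.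
  exists (snd @^-1` W), (curve_stage k); split=> //; first exact: open_snd.
    move=> [s y] /= Wy; rewrite /curve_stage /=.
    have Hk' i : (k <= i)%N -> ~ level_compact u i y.
      by move=> ki Ky; apply: (Hk i y ki Wy); exact: (level_compact_dom AC Ky).
    have [kk|kk] := leqP k (k0 y).
      by rewrite (stage_stable _ _ _ _ Hk' kk).
    by rewrite (stage_stable _ _ _ _ (Hk0 y) (ltnW kk)).
  by apply: smooth_wrt_in => //; exact: smooth_curve_stage.
- by move=> x; rewrite /curve_stage /= mxE slot_weight0 (stage0 AC).
- move=> k x; rewrite /curve_stage /= !mxE eqxx mulr1n slot_of_mid slot_weight_mid.
  have [i wi] := weight_eq1 AC x.
  apply: (stage1 AC (@adm _ _) wi); rewrite ltnNge; apply/negP => /(Hk0 x); apply.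
  apply: level_open_compact; apply: level_closed_open; apply: contrapT => /weight_out.
  by rewrite wi => /eqP; rewrite oner_eq0.
Qed.

End Curve.

(** * Strong neighbourhoods *)

Section RestrictedCharts.
Variables (R : realType) (m : nat) (M : manifold R m).
Implicit Types (c : chart R m M) (W : set M).

(** The strong topology wants the chart domains, and not just the compact sets, to be locally
    finite. Restrictions to open sets belong to the maximal atlas, though perhaps not to
    [atlas M]. *)
Definition restrict_chart c W : chart R m M :=
  {| cdom := W; cfun := cfun c; cinv := cinv c |}.

Lemma manifold_chart_restrict c W : atlas M c -> open W -> W `<=` cdom c ->
  manifold_chart (restrict_chart c W).
Proof.
move=> Mc oW Wc; have ic := atlas_chart Mc; have [oc orc cK cc ci] := ic.
split.
  split=> //=.
  - exact: (open_chart_image ic).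
  - by move=> x /Wc; exact: cK.
  - by move=> x /Wc; exact: cc.
  - by move=> _ [x /Wc cx <-]; apply: ci; exact: chart_crange.
move=> e Me; split.
  apply: smooth_onW (atlas_smooth Mc Me); apply: image_subset => x [Wx ex].
  by split=> //; exact: Wc.
apply: smooth_onW (atlas_smooth Me Mc); apply: image_subset => x [ex Wx].
by split=> //; exact: Wc.
Qed.

Lemma manifold_chart_atlas c : atlas M c -> manifold_chart c.
Proof.
move=> Mc; split; first exact: atlas_chart.
by move=> e Me; split; exact: atlas_smooth.
Qed.

End RestrictedCharts.

Lemma entry_le_eucl_norm (R : realType) n (v : 'rV[R]_n) j : `|v 0 j| <= eucl_norm v.
Proof.
rewrite -sqrtr_sqr ler_sqrt ?sumr_ge0// => [|i _]; last exact: sqr_ge0.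
by rewrite (bigD1 j)//= lerDl sumr_ge0// => i _; exact: sqr_ge0.
Qed.

Lemma norm_lt_eucl_norm (R : realType) n (v : 'rV[R]_n) e : eucl_norm v < e -> `|v| < e.
Proof.
move=> ve; rewrite [ltLHS]/Num.Def.normr/= mx_normrE; apply/bigmax_ltP; split.
  by apply: le_lt_trans ve; exact: sqrtr_ge0.
by move=> [i j] _; rewrite /= ord1; apply: le_lt_trans ve; exact: entry_le_eucl_norm.
Qed.

Lemma multi_partial0 (R : realType) m n (g : 'rV[R]_m -> 'rV[R]_n) :
  multi_partial (fun=> 0%N) g = g.
Proof. by rewrite /multi_partial /=; elim: (enum 'I_m). Qed.

Section StrongNeighbourhoods.
Variables (R : realType) (m n : nat) (M : manifold R m) (N : manifold R n).

Lemma eq_cinf (f g : Cinf M N) : (forall x, f x = g x) -> f = g.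
Proof.
case: f g => [f Sf] [g Sg] /= /funext fg; case: _ / fg Sg => Sg.
by congr MkCinf; exact: Prop_irrelevance.
Qed.

Lemma strong_topology_local (A : set (Cinf M N)) :
  (forall f, A f -> exists S, [/\ strong_subbasis S, S f & S `<=` A]) ->
  strong_topology M N A.
Proof.
move=> H; rewrite /strong_topology /open /=.
exists [set S | finI_from (@strong_subbasis R m n M N) id S /\ S `<=` A].
  by move=> S [].
apply/seteqP; split=> [f [S [_ SA] Sf]|f Af]; first exact: SA.
have [S [sS Sf SA]] := H f Af; exists S => //; split=> //.
exact: (finI_from1 id sS).
Qed.

Variables (f : Cinf M N) (c : nat -> chart R m M) (d : nat -> chart R n N)
  (u : nat -> M -> R).
Hypothesis AC : adapted_cover f c d u.
Variables (r : nat) (e : nat -> R).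
Hypothesis e_gt0 : forall i, 0 < e i.

Definition cover_nbhs : set (Cinf M N) :=
  \bigcap_i Nr r f (restrict_chart (c i) (level_dom c u i)) (d i)
    (level_compact u i) (e i).

Lemma cover_nbhs_subbasis : strong_subbasis cover_nbhs.
Proof.
exists r, f, nat, (fun i => restrict_chart (c i) (level_dom c u i)), d,
  (level_compact u), e; split=> // [i|x].
  split.
  - apply: manifold_chart_restrict; first exact: (cover_atlas AC).
      exact: (open_level_dom AC).
    by move=> x [].
  - by apply: manifold_chart_atlas; exact: (cover_target AC).
  - split; first exact: (compact_level_compact AC).
    exact: (level_compact_dom AC).
  - by move=> _ [x Kx <-]; exact: (level_compact_target AC Kx).
  - exact: e_gt0.
have [W [k [oW Wx Hk]]] := level_dom_finite AC x.
exists W; first exact: open_nbhs_nbhs.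
apply: (@sub_finite_set _ _ `I_k) (finite_II k) => i [y [Wy Uy]] /=.
by rewrite ltnNge; apply/negP => ki; exact: (Hk i y ki Wy Uy).
Qed.

Lemma cover_nbhs_center : cover_nbhs f.
Proof.
move=> i _; split=> [_ [x Kx <-]|v a _ _]; first exact: (level_compact_target AC Kx).
rewrite subrr /eucl_norm big1 ?sqrtr0// => j _.
by rewrite mxE expr0n.
Qed.

Lemma cover_nbhs_dom g i x : cover_nbhs g -> level_compact u i x -> cdom (d i) (g x).
Proof. by move=> /(_ i Logic.I)[H _] Kx; apply: H; exists x. Qed.

Lemma cover_nbhs_dist g i x : cover_nbhs g -> level_compact u i x ->
  `|cfun (d i) (f x) - cfun (d i) (g x)| < e i.
Proof.
move=> /(_ i Logic.I)[_ H] Kx; apply: norm_lt_eucl_norm.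
have := H (cfun (c i) x) (fun=> 0%N) _ _; rewrite !multi_partial0 /=.
have [_ _ K _ _] := atlas_chart (cover_atlas AC i).
rewrite K; last exact: (level_compact_source AC Kx).
apply; first by exists x.
by rewrite big1.
Qed.

(** By symmetry of partial derivatives the list s may be sorted, which gives the multi-index with
    entries [count_mem j s], of order [size s]; an entry is bounded by the Euclidean norm. *)
Lemma cover_nbhs_partials g i s (l : 'I_n) v : cover_nbhs g -> (size s <= r)%N ->
  (cfun (c i) @` level_compact u i) v ->
  `|dpart (@dirs R m) s (fun v => (cfun (d i) \o f \o cinv (c i)) v 0 l) v -
    dpart (@dirs R m) s (fun v => (cfun (d i) \o g \o cinv (c i)) v 0 l) v| < e i.
Proof.
move=> Sg sr [x Kx <-]; have Mi := cover_atlas AC i; have Ni := cover_target AC i.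
have [oc _ _ _ _] := atlas_chart Mi; have [od _ _ _ _] := atlas_chart Ni.
have cx := level_compact_source AC Kx.
have D (h : Cinf M N) : cdom (d i) (h x) ->
    dpart (@dirs R m) s (fun v => (cfun (d i) \o h \o cinv (c i)) v 0 l) (cfun (c i) x)
    = multi_partial (fun j => count_mem j s) (cfun (d i) \o h \o cinv (c i)) (cfun (c i) x) 0 l.
  move=> dhx; have [_ Sh] := cinf_smooth h.
  have oW : open (cfun (c i) @` (cdom (c i) `&` h @^-1` cdom (d i))).
    apply: open_chart_image; [exact: atlas_chart| |exact: subIsetl].
    by apply: open_preimage_in => // y _; exact: cinf_continuous.
  have Wx : (cfun (c i) @` (cdom (c i) `&` h @^-1` cdom (d i))) (cfun (c i) x) by exists x.
  have Shc := Sh _ _ Mi Ni.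
  rewrite (multi_partial_dpart _ _ oW Shc Wx).
  apply: (dpart_perm oW) => //; last exact: perm_flatten_count.
  exact: ((smooth_onP _ oW).1 Shc l).
rewrite !D; [|exact: (cover_nbhs_dom Sg)|exact: (level_compact_target AC Kx)].
have [_ H] := Sg i Logic.I.
have := H (cfun (c i) x) (fun j => count_mem j s) _ _; rewrite sum_count_mem => /(_ _ sr).
move=> He; apply: le_lt_trans (He _); last by exists x.
by apply: le_trans (entry_le_eucl_norm _ l); rewrite !mxE.
Qed.

End StrongNeighbourhoods.

Lemma D_open_strong_nbhs (R : realType) m n (M : manifold R m) (N : manifold R n)
    (A : set (Cinf M N)) (f : Cinf M N) : D_open A -> A f ->
  exists S, [/\ strong_subbasis S, S f & S `<=` A].
Proof.
move=> oA Af; have [[x0]|nM] := pselect (inhabited M); last first.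
  have E (g : Cinf M N) : f = g by apply: eq_cinf => x; case: nM.
  (* For empty M there is only one map, and the intersection of the empty family is the whole
     space. *)
  exists setT; split=> // [|g _]; last by rewrite -(E g).
  exists 0%N, f, Empty_set, (fun i : Empty_set => match i with end),
    (fun i : Empty_set => match i with end), (fun i : Empty_set => match i with end),
    (fun i : Empty_set => match i with end).
  split=> [[]|x|]; first by case: nM.
  by apply/seteqP; split=> // g _ [].
have cf x : {for x, continuous f} by exact: cinf_continuous.
have [c [d [u AC]]] := exists_adapted_cover x0 cf.
have [eps eps0 Heps] := slot_tolerance R.
have Hd i : exists e : R, 0 < e /\ forall x y, level_compact u i x ->
    cdom (d i) y -> `|cfun (d i) (f x) - cfun (d i) y| < e ->
    admissible f d u x y.
  by have [e e0 He] := admissible_radius AC i cf; exists e.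
have [del Hdel] := choice Hd.
(* [del i] makes g k admissible, [eps k] makes the curve smooth at time 0. *)
pose e k i := Num.min (del i) (eps k).
have e0 k i : 0 < e k i by rewrite lt_min eps0 (Hdel i).1.
apply: contrapT => nS.
have H k : exists g, cover_nbhs f c d u k (e k) g /\ ~ A g.
  apply: contrapT => nk; apply: nS; exists (cover_nbhs f c d u k (e k)); split.
  - exact: (cover_nbhs_subbasis AC).
  - exact: (cover_nbhs_center AC).
  - by move=> g Sg; apply: contrapT => nAg; apply: nk; exists g.
have [g Hg] := choice H.
have adm k x : admissible f d u x (g k x).
  have [Sg _] := Hg k; have [i wi] := weight_eq1 AC x.
  have Kx : level_compact u i x.
    apply: level_open_compact; apply: level_closed_open; apply: contrapT => /weight_out.
    by rewrite wi => /eqP; rewrite oner_eq0.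
  apply: ((Hdel i).2 _ _ Kx); first exact: (cover_nbhs_dom Sg Kx).
  apply: (lt_le_trans (cover_nbhs_dist AC Sg Kx)).
  by rewrite ge_min lexx.
have [|z [Sz z0 zk]] := exists_smooth_curve AC adm eps0 Heps.
  move=> i k s l v sk Kv; have [Sg _] := Hg k.
  apply: ltW; apply: (lt_le_trans (cover_nbhs_partials AC l Sg sk Kv)).
  by rewrite ge_min lexx orbT.
pose p t := MkCinf (smooth_wrt_slice t Sz).
have Pp : plot setT p.
  split; first exact: openT.
  have -> : (fun q : 'rV[R]_1 * M => p q.1 q.2) = z by apply/funext => -[].
  exact: Sz.
have nA : nbhs (0 : 'rV[R]_1) (setT `&` p @^-1` A).
  apply: open_nbhs_nbhs; split; first exact: oA Pp.
  by split=> //=; have -> : p 0 = f by apply: eq_cinf => x /=.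
have ct : (slot_mid R k)%:M @[k --> \oo] --> (0 : 'rV[R]_1).
  apply/cvgrPdist_lt => eta eta0.
  have nk : \forall k \near \oo, `|0 - slot_mid R k| < eta.
    by move/cvgrPdist_lt : (@slot_mid_cvg0 R) => /(_ _ eta0).
  near=> k; have ke : `|0 - slot_mid R k| < eta by near: k.
  rewrite sub0r normrN in ke.
  rewrite sub0r normrN [ltLHS]/Num.Def.normr/= mx_normrE.
  by apply/bigmax_ltP; split=> // -[i j] _ /=; rewrite !ord1 mxE eqxx mulr1n.
have [k _ Hk] := ct _ nA.
have [_ /= Ap] := Hk k (leqnn k).
have [_] := Hg k; apply; have <- // : p (slot_mid R k)%:M = g k.
by apply: eq_cinf => x /=.
Unshelve. all: by end_near. Qed.

Theorem theorem4p13 (R : realType) (m n : nat)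
    (M : manifold R m) (N : manifold R n) :
  D_topology M N `<=` strong_topology M N.
Proof.
by move=> A oA; apply: strong_topology_local => f Af; exact: D_open_strong_nbhs oA Af.
Qed.
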